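(* Consider the first-passage percolation model on $\mathbb{Z}^2$ with i.i.d. nonnegative edge weights, and suppose that the edge weight distribution has a density in the class $\mathcal{P}^+(1)$. Let $x_n$ and $y_n$ be two sequences of points in $\mathbb{Z}^2$ such that the distance between $x_n$ and $y_n$ grows like a constant multiple of $n$, that is, there are constants $0<c\le C<\infty$ such that $cn\le\|x_n-y_n\|\le Cn$ for all large $n$. Then the fluctuations of the first-passage time $T(x_n,y_n)$ are of order at least $\sqrt{\log n}$.
   Context: First-passage percolation: let $E$ be the set of nearest-neighbor edges of $\mathbb{Z}^2$ and let $(\omega_e)_{e\in E}$ be i.i.d. nonnegative random variables (edge weights). The weight of a path is the sum of the weights of its edges, and the first-passage time $T(x,y)$ is the minimum of the weights of all paths from $x$ to $y$. Class $\mathcal{P}^+(1)$: the set of all probability densities of the form $e^{-V}$ on $[0,\infty)$, such that $V$ is a $C^\infty$ function in $(0,\infty)$, $V$ and all its derivatives have at most polynomial growth at infinity and extend continuously to $0$, and $e^{V}$ increases faster than any polynomial at infinity. Fluctuations: for a sequence of random variables $\{X_n\}$ and a sequence of positive real numbers $\{\delta_n\}$, we say that $X_n$ has fluctuations of order at least $\delta_n$ if there are positive constants $c_1,c_2$ such that for all large $n$, and for all $-\infty<a\le b<\infty$ with $b-a\le c_1\delta_n$, $\mathbb{P}(a\le X_n\le b)\le 1-c_2$. *)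

(* Defs.v *)
From mathcomp Require Import all_boot all_order all_algebra.
From mathcomp Require Import all_classical all_reals all_analysis.
From mathcomp Require Import zify.

Set Implicit Arguments.
Unset Strict Implicit.
Unset Printing Implicit Defensive.
Import Order.TTheory GRing.Theory Num.Theory.
Import numFieldNormedType.Exports.

Local Open Scope classical_set_scope.
Local Open Scope ring_scope.

Definition vertex : Type := (int * int)%type.

Definition adjacent : rel vertex :=
  fun u v => `|u.1 - v.1| + `|u.2 - v.2| == 1.

Definition euclidean_dist (R : realType) (u v : vertex) : R :=
  Num.sqrt ((u.1 - v.1)%:~R ^+ 2 + (u.2 - v.2)%:~R ^+ 2).

(* (u, false) stands for the unoriented edge {u, u + (1, 0)} and (u, true) for
   {u, u + (0, 1)}; every nearest-neighbor edge has exactly one such code. *)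
Definition edge : Type := (vertex * bool)%type.

Definition endpoints (e : edge) : vertex * vertex :=
  (e.1, if e.2 then (e.1.1, e.1.2 + 1) else (e.1.1 + 1, e.1.2)).

(* Only meaningful when u and v are adjacent. *)
Definition edge_of (u v : vertex) : edge :=
  ((Num.min u.1 v.1, Num.min u.2 v.2), u.2 != v.2).

Lemma adjacent_endpoints (e : edge) :
  adjacent (endpoints e).1 (endpoints e).2.
Proof. by case: e => -[a b] []; rewrite /adjacent /=; apply/eqP; lia. Qed.

Lemma edge_of_endpoints (e : edge) :
  edge_of (endpoints e).1 (endpoints e).2 = e.
Proof.
case: e => -[a b] []; rewrite /edge_of /=; congr (_, _, _); lia.
Qed.

Lemma endpoints_edge_of (u v : vertex) : adjacent u v ->
  endpoints (edge_of u v) = (u, v) \/ endpoints (edge_of u v) = (v, u).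
Proof.
case: u v => [a b] [c d]; rewrite /adjacent /endpoints /edge_of /= => /eqP h.
case: (eqVneq b d) => /= bd; case: (ltP a c) => ac; case: (ltP b d) => bd';
  solve [left; congr (_, _, (_, _)); lia | right; congr (_, _, (_, _)); lia].
Qed.

(* A path from u to v is given by the list p of its vertices after u. *)
Definition is_path (u v : vertex) (p : seq vertex) : bool :=
  path adjacent u p && (last u p == v).

Definition path_weight (R : realType) (w : edge -> R) (u : vertex)
    (p : seq vertex) : R :=
  \sum_(e <- pairmap edge_of u p) w e.

(* The minimum over paths is taken as an infimum; the two agree whenever the
   minimum exists. *)
Definition passage_time (R : realType) (w : edge -> R) (u v : vertex) : R :=
  inf [set path_weight w u p | p in [set p | is_path u v p]].

Section random_variables.
Context {d : measure_display} {T : measurableType d} {R : realType}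
  {P : probability T R}.

Definition passage_time_fun (w : edge -> {RV P >-> R}) (u v : vertex)
  : T -> R := fun t => passage_time (fun e => w e t) u v.

Lemma measurable_passage_time (w : edge -> {RV P >-> R})
    (w_ge0 : forall e t, 0 <= w e t) (u v : vertex) :
  measurable_fun [set: T] (passage_time_fun w u v).
Proof.
have mW p : measurable_fun [set: T] (fun t => path_weight (fun e => w e t) u p).
  by apply: measurable_sum => e; exact: measurable_funPT.
have [[p0 pp0]|nop] := pselect (exists p, is_path u v p); last first.
  apply: (eq_measurable_fun (cst (inf set0))) => [t _|]; last exact: measurable_cst.
  rewrite /passage_time_fun /passage_time /cst; congr inf.
  by apply/esym; rewrite -subset0 => r [p pp _]; apply: nop; exists p.
move=> _; apply: (measurability _ (measurable_realfun.RGenInftyO.measurableE R)) => //.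
move=> _ [_ [r ->] <-]; rewrite setTI.
have -> : passage_time_fun w u v @^-1` `]-oo, r[%classic =
    \bigcup_(p in [set: seq vertex]) (if is_path u v p then
      (fun t => path_weight (fun e => w e t) u p) @^-1` `]-oo, r[%classic
      else set0).
  apply/seteqP; split => [t|t [p _]] /=.
    rewrite in_itv /= => lr.
    have ne : [set path_weight (fun e => w e t) u p
                 | p in [set p | is_path u v p]] !=set0.
      by exists (path_weight (fun e => w e t) u p0), p0.
    have [_ [p pp <-] pr] := inf_lt ne lr.
    by exists p => //; rewrite (pp : is_path u v p) /= in_itv.
  case: ifPn => // pp; rewrite /= !in_itv /= => pr; apply: le_lt_trans pr.
  apply: ge_inf; last by exists p.
  by exists 0 => _ [q _ <-]; apply: sumr_ge0.
apply: countable_bigcupT_measurable; first exact: countableP.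
move=> p; case: ifPn => // _.
by rewrite -[X in measurable X]setTI; exact: mW.
Qed.

Definition passage_time_rv (w : edge -> {RV P >-> R})
    (w_ge0 : forall e t, 0 <= w e t) (u v : vertex) : {RV P >-> R} :=
  mfun_Sub (mem_set (measurable_passage_time w_ge0 u v)).

Definition mutually_independent (I : eqType) (X : I -> {RV P >-> R}) : Prop :=
  forall (s : seq I) (B : I -> set R), uniq s ->
    (forall i, measurable (B i)) ->
    P (\bigcap_(i in [set` s]) (X i @^-1` B i)) =
    (\prod_(i <- s) P (X i @^-1` B i))%E.

Definition identically_distributed (I : Type) (X : I -> {RV P >-> R}) : Prop :=
  forall (i j : I) (B : set R), measurable B ->
    distribution P (X i) B = distribution P (X j) B.

(* Only the values of f on [0, +oo[ matter. *)
Definition has_density_on_halfline (X : {RV P >-> R}) (f : R -> R) : Prop :=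
  forall B : set R, measurable B ->
    distribution P X B =
    (\int[lebesgue_measure]_(x in B `&` `[0%R, +oo[) (f x)%:E)%E.

Definition fluctuations_of_order_at_least (X : nat -> {RV P >-> R})
    (delta : nat -> R) : Prop :=
  exists c1 c2 : R, [/\ 0 < c1, 0 < c2 &
    \forall n \near \oo, forall a b : R, a <= b -> b - a <= c1 * delta n ->
      (P [set t | (a <= X n t <= b)%R] <= (1 - c2)%:E)%E].

End random_variables.

(* The class P^+(1) of densities on [0, +oo[. The value V 0 is left free: it
   does not affect the distribution. *)
Definition class_Pplus1 (R : realType) (f : R -> R) : Prop :=
  (\int[lebesgue_measure]_(x in `[0%R, +oo[) (f x)%:E = 1)%E /\
  exists V : R -> R,
    [/\ forall x, 0 <= x -> f x = expR (- V x),
        forall (k : nat) (x : R), 0 < x -> derivable (derive1n k V) x 1,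
        forall k : nat, exists (C : R) (m : nat),
          \forall x \near +oo, `|derive1n k V x| <= C * x ^+ m,
        forall k : nat, cvg (derive1n k V x @[x --> (0 : R)^'+]) &
        forall m : nat, expR (V x) / x ^+ m @[x --> +oo] --> +oo].

(* Main.v *)
From Pilot Require Import Defs.
From mathcomp Require Import all_boot all_order all_algebra.
From mathcomp Require Import all_classical all_reals all_analysis.
From mathcomp Require Import measurable_realfun zify ring lra.
Import Order.TTheory GRing.Theory Num.Theory.
Import numFieldNormedType.Exports.
(* A later import has its own [adjacent]; the graph relation is wanted. *)
Import Pilot.Defs.
Local Open Scope classical_set_scope.
Local Open Scope ring_scope.
Set Implicit Arguments.
Unset Strict Implicit.
Unset Printing Implicit Defensive.

(** Why the theorem is true. Let F be the common distribution function of the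
    edge weights. Increase every weight a little, by an amount eps_e of order
    1 / (r * sqrt (log n)), where r is the distance from e to the starting
    point x_n. Two facts are in tension with strong concentration.

    - The law hardly changes. The increase is the monotone (quantile) coupling
      [boost] of the law of a weight with the law whose density with respect to
      it is 1 - eps below the median and 1 + eps above. By independence the
      joint law of the increased weights has density prod_e (1 +- eps_e) with
      respect to the original one ([boosted_law]), and the second moment of this
      density is prod_e (1 + eps_e ^ 2) <= exp (sum_e eps_e ^ 2). In the plane
      about r edges lie at distance r, so the sum is of order
      sum_r r / (r ^ 2 * log n), which is bounded. Hence an event of small
      probability for the original weights has probability bounded away from 1
      for the increased ones ([tilted_le]).

    - The passage time changes a lot. Since F is Lipschitz, a weight that is not
      in the extreme tails of its law increases by at least a multiple of eps_e
      ([boost_gain]). A counting argument ([bad_before_le]) shows that, with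
      probability at least 6/7, along every self-avoiding path from x_n more
      than half of the first m edges have such a weight, for all m <= n. The i-th edge
      of a path from x_n is within distance i of x_n, so the path gains at least
      a multiple of sum_(i <= n) 1 / (i * sqrt (log n)), that is of
      sqrt (log n) ([boosted_path_gain]). This holds for all paths at once, so
      T(x_n, y_n) itself grows by that much.

    If T(x_n, y_n) stayed in an interval shorter than this growth with
    probability close to 1, then after the increase it would leave the interval
    with probability at least about 6/7 by the second fact, and with
    probability at most about 1/4 by the first
    ([passage_time_anticoncentration]).

    With the harmonic sum H of the distance in place of log n, both sums above
    are bounded by multiples of H, and the logarithm enters only through the
    comparison [sqrt_ln_le]. *)

(** * Lattice paths *)

Definition l1_dist (u v : vertex) : nat := (`|u.1 - v.1| + `|u.2 - v.2|)%N.

Lemma l1_step (o u v : vertex) : adjacent u v -> (l1_dist o v <= (l1_dist o u).+1)%N.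
Proof. by rewrite /adjacent /l1_dist => /eqP; lia. Qed.

Lemma l1_edge_of (o u v : vertex) : adjacent u v ->
  (l1_dist o (edge_of u v).1 <= (l1_dist o u).+1)%N.
Proof.
by rewrite /adjacent /l1_dist /edge_of /= => /eqP; case: (leP u.1 v.1);
  case: (leP u.2 v.2); lia.
Qed.

Lemma l1_path_edge (o u : vertex) (p : seq vertex) (k i : nat) (e0 : edge) :
  path adjacent u p -> (l1_dist o u <= k)%N -> (i < size p)%N ->
  (l1_dist o (nth e0 (pairmap edge_of u p) i).1 <= (k + i).+1)%N.
Proof.
elim: p u k i => [//|v p IH] u k [|i] /= /andP[uv vp] ouk.
  by rewrite addn0 => _; rewrite (leq_trans (l1_edge_of o uv)).
rewrite ltnS addnS -addSn; apply: IH => //.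
by rewrite (leq_trans (l1_step o uv)).
Qed.

Lemma l1_path_size (o u : vertex) (p : seq vertex) : path adjacent u p ->
  (l1_dist o (last u p) <= l1_dist o u + size p)%N.
Proof.
elim: p u => [|v p IH] u /=; first by rewrite addn0.
move=> /andP[uv /IH] h; rewrite (leq_trans h)// addnS -addSn leq_add2r.
exact: l1_step.
Qed.

Lemma exists_path (u v : vertex) : exists p, is_path u v p.
Proof.
have [n] := ubnP (l1_dist u v); elim: n u => // n IH u luv.
have [->|uv] := eqVneq u v; first by exists [::]; rewrite /is_path /= eqxx.
have [u' uu' lu'] : exists2 u', adjacent u u' & (l1_dist u' v < l1_dist u v)%N.
  case: u v uv {luv IH} => [a b] [c d]; rewrite /l1_dist /adjacent /= xpair_eqE => uv.
  have [ac|ac|ac] := ltgtP a c.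
  - by exists (a + 1, b) => /=; [apply/eqP|]; lia.
  - by exists (a - 1, b) => /=; [apply/eqP|]; lia.
  have [bd|bd|bd] := ltgtP b d.
  - by exists (a, b + 1) => /=; [apply/eqP|]; lia.
  - by exists (a, b - 1) => /=; [apply/eqP|]; lia.
  by rewrite ac bd !eqxx in uv.
have [|p] := IH u'; first by lia.
by move=> /andP[pp lp]; exists (u' :: p); rewrite /is_path /= uu' pp.
Qed.

Lemma path_weight_cons (R : realType) (g : edge -> R) u v p :
  path_weight g u (v :: p) = g (edge_of u v) + path_weight g v p.
Proof. by rewrite /path_weight /= big_cons. Qed.

Lemma path_weight_cat (R : realType) (g : edge -> R) u p q :
  path_weight g u (p ++ q) = path_weight g u p + path_weight g (last u p) q.
Proof. by rewrite /path_weight pairmap_cat big_cat. Qed.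

Lemma path_weight_ge0 (R : realType) (g : edge -> R) u p :
  (forall e, 0 <= g e) -> 0 <= path_weight g u p.
Proof. by move=> g0; apply: sumr_ge0. Qed.

(** Deleting a loop removes edges and adds none, so for nonnegative weights a
    lower bound over self-avoiding paths is one over all paths. Self-avoiding
    paths are needed because their edges are distinct, hence independent. *)
Lemma loop_erasure (R : realType) (g : edge -> R) u p :
  (forall e, 0 <= g e) -> path adjacent u p ->
  exists q, [/\ path adjacent u q, last u q = last u p, uniq (u :: q)
    & path_weight g u q <= path_weight g u p].
Proof.
move=> g0; elim: p u => [|v p IH] u; first by exists [::].
move=> /= /andP[uv /IH[q [vq lq uq wq]]].
have [uin|unin] := boolP (u \in v :: q); last first.
  exists (v :: q); split => //=; [by rewrite uv vq| by rewrite unin |].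
  by rewrite !path_weight_cons lerD2l.
have [q1 [q2 eqq]] : exists q1 q2, v :: q = q1 ++ u :: q2.
  by case/splitPr: uin => q1 q2; exists q1, q2.
have uvq : path adjacent u (v :: q) by rewrite /= uv.
exists q2; split.
- by move: uvq; rewrite eqq cat_path /= => /and3P[].
- by rewrite -lq -[last v q]/(last u (v :: q)) eqq last_cat.
- by move: uq; rewrite eqq cat_uniq => /and3P[].
- have le_vq : path_weight g u q2 <= path_weight g u (v :: q).
    rewrite eqq path_weight_cat path_weight_cons addrA lerDr.
    by rewrite addr_ge0// path_weight_ge0.
  by rewrite (le_trans le_vq)// !path_weight_cons lerD2l.
Qed.

Lemma mem_endpoints_path (u a b : vertex) (p : seq vertex) (e : edge) :
  path adjacent u p -> e \in pairmap edge_of u p -> endpoints e = (a, b) ->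
  (a \in u :: p) && (b \in u :: p).
Proof.
move=> + + eab; elim: p u => [//|v p IH] u /= /andP[uv vp].
rewrite inE => /predU1P[eE|/(IH _ vp)/andP[h1 h2]]; last first.
  by rewrite inE h1 orbT inE h2 orbT.
move: eab; rewrite eE.
by case: (endpoints_edge_of uv) => -> [<- <-]; rewrite !inE !eqxx !orbT.
Qed.

(** A repeated edge would bring the path back to an endpoint it has left. *)
Lemma uniq_path_edges (u : vertex) (p : seq vertex) :
  path adjacent u p -> uniq (u :: p) -> uniq (pairmap edge_of u p).
Proof.
elim: p u => [//|v p IH] u /= /andP[uv vp] /andP[unin uvp].
rewrite IH// andbT; apply/negP => euv.
case: (endpoints_edge_of uv) => /(mem_endpoints_path vp euv)/andP[h1 h2].
  by rewrite h1 in unin.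
by rewrite h2 in unin.
Qed.

(** Summation by parts: the sum is a combination of the partial sums of [c]
    with the nonnegative coefficients [h i - h i.+1]. *)
Lemma abel_sum_ge0 (R : realType) (h c : nat -> R) (n : nat) :
  (forall i, 0 <= h i) -> (forall i, h i.+1 <= h i) ->
  (forall m, (m <= n)%N -> 0 <= \sum_(i < m) c i) ->
  0 <= \sum_(i < n) h i * c i.
Proof.
move=> h0 hd cs.
suff H m : (m <= n)%N -> h m * \sum_(i < m) c i <= \sum_(i < m) h i * c i.
  by apply: le_trans (H _ (leqnn n)); apply: mulr_ge0 => //; exact: cs.
elim: m => [_|m IH mn]; first by rewrite !big_ord0 mulr0.
apply: (le_trans (ler_wpM2r (cs _ mn) (hd m))).
by rewrite !big_ord_recr /= mulrDr lerD2r IH// ltnW.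
Qed.

(** The [i]-th edge is within distance [i.+1] of [x] whatever the path does, so
    a radially decreasing gain [h] is at least [h i.+1] on it. As good edges are
    in the majority among the first [m] for every [m], summation by parts loses
    only a factor 2. *)
Lemma path_gain (R : realType) (h : nat -> R) (good : pred edge)
    (inc : edge -> R) (x : vertex) (q : seq vertex) (n : nat) :
  (forall i, 0 <= h i) -> (forall i, h i.+1 <= h i) ->
  (forall e, 0 <= inc e) ->
  (forall e, good e -> (l1_dist x e.1 <= n)%N -> h (l1_dist x e.1) <= inc e) ->
  path adjacent x q -> (n <= size q)%N ->
  (forall m, (0 < m <= n)%N ->
     (2 * count (predC good) (take m (pairmap edge_of x q)) < m)%N) ->
  2^-1 * \sum_(i < n) h i.+1 <= path_weight inc x q.
Proof.
move=> h0 hd inc0 hinc xq nq few.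
set E := pairmap edge_of x q in few *.
have sE : size E = size q by rewrite size_pairmap.
have hle i j : (i <= j)%N -> h j <= h i.
  by elim: j => [|j IH]; [case: i|rewrite leq_eqVlt => /predU1P[->//|/IH]; exact: le_trans].
pose e0 : edge := (x, false).
(* By the majority hypothesis the partial sums of [c] are nonnegative. *)
pose c i : R := (good (nth e0 E i))%:R - 2^-1.
have step1 : \sum_(i < n) h i.+1 * (good (nth e0 E i))%:R <= path_weight inc x q.
  rewrite /path_weight -/E (big_nth e0) sE (big_cat_nat _ nq)//=.
  rewrite -[leLHS]addr0 lerD//; last by apply: sumr_ge0.
  rewrite big_mkord; apply: ler_sum => i _.
  have [gi|] := boolP (good _); last by rewrite mulr0.
  have li : (l1_dist x (nth e0 E i).1 <= i.+1)%N.
    rewrite -[i.+1]/((0 + i).+1); apply: l1_path_edge => //; last exact: (leq_trans _ nq).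
    by rewrite /l1_dist !subrr.
  rewrite mulr1; apply: le_trans (hinc _ gi _); first exact: hle.
  exact: leq_trans li _.
apply: le_trans step1; rewrite mulr_sumr -subr_ge0 -sumrB.
rewrite (eq_bigr (fun i : 'I_n => h i.+1 * c i)); last first.
  by move=> i _; rewrite /c mulrBr [_ * 2^-1]mulrC.
apply: (@abel_sum_ge0 R (fun i => h i.+1) c) => // m mn.
have cnt : \sum_(i < m) (good (nth e0 E i))%:R = (count good (take m E))%:R :> R.
  rewrite -sum1_count (big_nth e0) size_take sE.
  have -> : (if (m < size q)%N then m else size q) = m by case: ltnP => //; lia.
  rewrite big_mkord natr_sum [RHS]big_mkcond/=; apply: eq_bigr => i _.
  by rewrite nth_take//; case: (good _).
rewrite sumrB cnt sumr_const card_ord.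
have [->|m0] := posnP m; first by rewrite mulr0n subr0 ler0n.
have := few m; rewrite m0 mn => /(_ isT).
have := count_predC good (take m E); rewrite size_takel ?sE; last by lia.
set a := count _ _; set b := count _ _ => ab bm.
have am : (m <= a * 2)%N by lia.
have : m%:R <= (a * 2)%:R :> R by rewrite ler_nat.
by rewrite natrM -mulr_natr; lra.
Qed.

(** * Harmonic sums over the lattice *)

Definition harmonic_sum (R : realType) (n : nat) : R := \sum_(i < n) i.+1%:R^-1.

Lemma ln_le_harmonic_sum (R : realType) (n : nat) :
  ln n.+1%:R <= harmonic_sum R n.
Proof.
elim: n => [|n IH]; first by rewrite ln1 /harmonic_sum big_ord0.
rewrite /harmonic_sum big_ord_recr /= -/(harmonic_sum R n).
have -> : n.+2%:R = n.+1%:R * (1 + n.+1%:R^-1) :> R.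
  by rewrite mulrDr mulr1 mulfV ?pnatr_eq0// -[in LHS]natr1.
have n0 : 0 <= n.+1%:R^-1 :> R by rewrite invr_ge0 ler0n.
rewrite lnM ?posrE ?ltr0n ?ltr_wpDr// lerD//.
apply: le_ln1Dx; exact: lt_le_trans n0.
Qed.

Lemma harmonic_sumS_le (R : realType) (n : nat) : (0 < n)%N ->
  harmonic_sum R n.+1 <= 2 * harmonic_sum R n.
Proof.
case: n => // n _; rewrite /harmonic_sum big_ord_recr /= mulr_natl mulr2n lerD2l.
rewrite big_ord_recl /= invr1 (@le_trans _ _ 1)//.
  by rewrite invf_le1 ?ler1n ?ltr0n.
by rewrite lerDl sumr_ge0.
Qed.

(** The terms after the first telescope: 1/(z+1)^2 <= 1/z - 1/(z+1). *)
Lemma sum_inv_sq_le (R : realType) (i n : nat) :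
  \sum_(j < n) ((i + j).+1%:R ^+ 2)^-1 <= 2 * i.+1%:R^-1 :> R.
Proof.
have i0 : (0:R) < i.+1%:R by rewrite ltr0n.
suff H m : \sum_(j < m.+1) ((i + j).+1%:R ^+ 2)^-1 <=
    2 * i.+1%:R^-1 - (i + m).+1%:R^-1 :> R.
  case: n => [|n]; first by rewrite big_ord0 mulr_ge0// invr_ge0 ltW.
  by apply: (le_trans (H n)); rewrite gerBl invr_ge0 ler0n.
elim: m => [|m IH].
  rewrite big_ord_recl big_ord0 addr0 /= addn0.
  rewrite mulr_natl mulr2n addrK -exprVn -[leRHS]expr1.
  apply: ler_wiXn2l => //.
  by rewrite invf_le1// ler1n.
rewrite big_ord_recr /= (le_trans (lerD IH (lexx _)))// -addrA lerD2l.
rewrite addnS; set k := (i + m)%N.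
have k1 : (0:R) < k.+1%:R by rewrite ltr0n.
have -> : k.+2%:R = k.+1%:R + 1 :> R by rewrite -natr1.
set z := k.+1%:R in k1 *.
rewrite -lerBrDl opprK [leRHS]addrC.
have -> : z^-1 - (z + 1)^-1 = (z * (z + 1))^-1.
  by field; rewrite !gt_eqF// addr_gt0.
rewrite lef_pV2 ?posrE ?exprn_gt0 ?mulr_gt0 ?addr_gt0//.
by rewrite expr2 ler_wpM2r ?addr_ge0 ?ltW// ltrDl.
Qed.

Lemma sum_undup_le (R : realType) (I : eqType) (s : seq I) (g : I -> R) :
  (forall i, 0 <= g i) -> \sum_(i <- undup s) g i <= \sum_(i <- s) g i.
Proof.
move=> g0; elim: s => [|i s IH] /=; first by rewrite !big_nil.
by case: ifP => _; rewrite !big_cons ?lerD2l//; exact: ler_wpDl.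
Qed.

(** An edge near [x] is coded by the absolute values of the two coordinates of
    its base point relative to [x], their signs, and its direction. A zero
    coordinate has two codes, hence the [undup] in [ball_edges]. *)
Definition ball_index (n : nat) : finType :=
  ('I_n.+1 * 'I_n.+1 * (bool * bool * bool))%type.

Definition ball_edge (x : vertex) (n : nat) (k : ball_index n) : edge :=
  ((x.1 + (-1) ^+ k.2.1.1 * (nat_of_ord k.1.1)%:Z,
    x.2 + (-1) ^+ k.2.1.2 * (nat_of_ord k.1.2)%:Z), k.2.2).

Definition ball_edges (x : vertex) (n : nat) : seq edge :=
  undup [seq ball_edge x k | k <- enum (ball_index n)].

Lemma l1_ball_edge (x : vertex) (n : nat) (k : ball_index n) :
  l1_dist x (ball_edge x k).1 = (k.1.1 + k.1.2)%N.
Proof.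
by case: k => [[i j] [[[] []] b]]; rewrite /l1_dist /ball_edge /= ?expr1 ?expr0; lia.
Qed.

Lemma mem_ball_edges (x : vertex) (n : nat) (e : edge) :
  (l1_dist x e.1 <= n)%N -> e \in ball_edges x n.
Proof.
case: e => -[a c] b; rewrite /l1_dist /= => h.
have ia : (`|x.1 - a| < n.+1)%N by lia.
have ic : (`|x.2 - c| < n.+1)%N by lia.
rewrite mem_undup; apply/mapP.
exists ((Ordinal ia, Ordinal ic), ((a < x.1, c < x.2), b)).
  by rewrite mem_enum.
rewrite /ball_edge /=; congr (_, _, _);
  by [case: (ltP a x.1) => ?; rewrite ?expr1 ?expr0; lia
     |case: (ltP c x.2) => ?; rewrite ?expr1 ?expr0; lia].
Qed.

(** The two-dimensional sum of 1/(r+1)^2 is reduced to a one-dimensional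
    harmonic sum by summing over one coordinate first. *)
Lemma sum_ball_edges_le (R : realType) (x : vertex) (n : nat) : (0 < n)%N ->
  \sum_(e <- ball_edges x n) ((l1_dist x e.1).+1%:R ^+ 2)^-1
    <= 32 * harmonic_sum R n.
Proof.
move=> n0; apply: le_trans (sum_undup_le _ _) _.
  by move=> e; rewrite invr_ge0 exprn_ge0.
rewrite big_map big_enum /=.
rewrite (eq_bigr (fun k : ball_index n => (((k.1.1 + k.1.2).+1)%:R ^+ 2)^-1)); last first.
  by move=> k _; rewrite l1_ball_edge.
rewrite -(pair_bigA _ (fun (p : 'I_n.+1 * 'I_n.+1) (_ : bool * bool * bool) =>
  ((p.1 + p.2).+1%:R ^+ 2)^-1))/=.
under eq_bigr do rewrite sumr_const.
rewrite !card_prod !card_bool -(pair_bigA _ (fun (i j : 'I_n.+1) =>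
  ((i + j).+1%:R ^+ 2)^-1 *+ 8))/=.
apply: (@le_trans _ _ (\sum_(i < n.+1) (16 * i.+1%:R^-1))).
  apply: ler_sum => i _; rewrite sumrMnl -[leLHS]mulr_natr.
  have h8 : (0 : R) <= 8%:R by [].
  apply: (le_trans (ler_wpM2r h8 (sum_inv_sq_le R i n.+1))).
  by rewrite mulrAC ler_wpM2r// ?invr_ge0//; lra.
rewrite -mulr_sumr.
by have := harmonic_sumS_le R n0; rewrite /harmonic_sum; lra.
Qed.

(** * The distribution function of an edge weight *)

(** What the coupling needs of the distribution function of a nonnegative
    variable. The Lipschitz bound, that is a bounded density, turns an increase
    measured in probability into an increase of the weight. *)
Record regular_cdf {R : realType} (F : R -> R) (M : R) : Prop := RegularCdf {
  rcdf_nd : forall x y, x <= y -> F x <= F y;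
  rcdf_le0 : forall x, x <= 0 -> F x = 0;
  rcdf_lt : forall x y, 0 <= x -> x < y -> F x < F y;
  rcdf_lt1 : forall x, F x < 1;
  rcdf_near1 : forall v, v < 1 -> exists b, v < F b;
  rcdf_M_gt0 : 0 < M;
  rcdf_lipschitz : forall x y, x <= y -> F y - F x <= M * (y - x) }.

Section density.
Context {R : realType} (f : R -> R) (f_class : class_Pplus1 f).

Lemma density_gt0 (x : R) : 0 <= x -> 0 < f x.
Proof. by move=> x0; case: f_class => _ [V [fV _ _ _ _]]; rewrite fV// expR_gt0. Qed.

Lemma density_continuous (x : R) : 0 < x -> {for x, continuous f}.
Proof.
move=> x0; case: f_class => _ [V [fV dV _ _ _]].
have cV : {for x, continuous V}.
  by apply: differentiable_continuous; apply/derivable1_diffP; exact: (dV 0%N).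
have cE : {for x, continuous (fun y => expR (- V y))}.
  apply: continuous_comp; last exact: continuous_expR.
  exact: continuousN.
rewrite /prop_for/continuous_at fV ?ltW//.
apply: cvg_trans cE; apply: near_eq_cvg.
by near=> y; rewrite fV// ltW//; near: y; exact: lt_nbhsr.
Unshelve. all: by end_near. Qed.

Lemma density_within_continuous (a b : R) : 0 < a ->
  {within `[a, b], continuous f}.
Proof.
move=> a0; apply: continuous_in_subspaceT => x; rewrite inE /= in_itv /= => /andP[ax _].
exact: density_continuous (lt_le_trans a0 ax).
Qed.

(** Near 0 the potential converges, near infinity it is nonnegative because its
    exponential tends to infinity, and in between it is continuous. *)
Lemma density_bounded : exists2 M : R, 0 < M & forall x, 0 < x -> f x <= M.
Proof.
case: f_class => _ [V [fV dV _ /(_ 0%N) V0 /(_ 0%N) Voo]].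
have /cvgrPdist_lt/(_ 1 ltr01)[e /= e0 he] := V0.
have [B [_ hB]] : \forall x \near +oo, 1 <= expR (V x) / x ^+ 0.
  by move/cvgryPge: Voo; exact.
pose L := lim (V x @[x --> 0^'+]).
pose B' := Num.max B e.
have eB : e / 2 <= B' by rewrite le_max orbC; apply/orP; left; rewrite /= in e0 *; lra.
have e20 : 0 < e / 2 by rewrite divr_gt0.
have [c _ hc] := EVT_max eB (density_within_continuous e20).
exists (expR (1 - L) + 1 + `|f c|) => [|x x0].
  by rewrite ltr_wpDr// addr_gt0// expR_gt0.
have [xe|ex] := ltP x (e / 2).
  rewrite -addrA; apply: ler_wpDr; first by rewrite addr_ge0.
  rewrite (fV _ (ltW x0)) ler_expR.
  have := he x; rewrite /= sub0r normrN gtr0_norm// => /(_ _ x0).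
  rewrite -/L ltr_norml => /(_ _)/andP[]; last by lra.
  by rewrite /= in e0 *; lra.
have [xB|Bx] := leP x B'.
  apply: ler_wpDl; first by rewrite addr_ge0 ?expR_ge0.
  by apply: le_trans (ler_norm _); apply: hc; rewrite in_itv /= ex.
rewrite -addrA; apply: ler_wpDl; first exact: expR_ge0.
apply: ler_wpDr => //; rewrite (fV _ (ltW x0)) expRN invf_le1 ?expR_gt0//.
have := hB x; rewrite expr0 divr1; apply.
by apply: le_lt_trans Bx; rewrite le_max lexx.
Qed.

Lemma measurable_density (B : set R) : measurable B -> B `<=` `]0, +oo[ ->
  measurable_fun B f.
Proof.
move=> mB B0; apply: (measurable_funS _ B0); first exact: measurable_itv.
apply: subspace_continuous_measurable_fun => //.
apply: continuous_in_subspaceT => x; rewrite inE /= in_itv /= andbT.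
exact: density_continuous.
Qed.

Definition density_cdf (x : R) : R :=
  fine (\int[lebesgue_measure]_(y in `]-oo, x] `&` `[0%R, +oo[) (f y)%:E)%E.

Section random_variable.
Context d (T : measurableType d) (P : probability T R) (X : {RV P >-> R})
  (X_density : has_density_on_halfline X f).

Lemma density_cdfE (x : R) :
  P (X @^-1` `]-oo, x]) = (density_cdf x)%:E.
Proof.
rewrite /density_cdf -X_density; last exact: measurable_itv.
by rewrite fineK// fin_num_measure.
Qed.

Lemma density_cdf_le1 (x : R) : density_cdf x <= 1.
Proof.
rewrite -lee_fin -density_cdfE probability_le1//.
exact: measurable_funPTI.
Qed.

Lemma density_cdf_le0 (x : R) : x <= 0 -> density_cdf x = 0.
Proof.
move=> x0; rewrite /density_cdf (_ : _ `&` _ = if x == 0 then [set 0] else set0).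
  by case: ifP => _; rewrite ?integral_set1 ?integral_set0.
apply/seteqP; split => [y [] /=|y]; rewrite ?in_itv /= ?andbT.
  move=> yx y0; have xE : x = 0 by apply/le_anti; rewrite x0 (le_trans y0).
  by rewrite xE eqxx /=; apply/le_anti; rewrite y0 -xE yx.
by case: eqVneq => // -> /= ->; rewrite !in_itv /= lexx.
Qed.

Lemma density_cdfB (x y : R) : 0 <= x -> x <= y ->
  ((density_cdf y - density_cdf x)%:E =
  \int[lebesgue_measure]_(z in `]x, y]) (f z)%:E)%E.
Proof.
move=> x0 xy.
have -> : (\int[lebesgue_measure]_(z in `]x, y]) (f z)%:E)%E = P (X @^-1` `]x, y]).
  rewrite -[RHS]/(distribution P X `]x, y]) X_density; last exact: measurable_itv.
  congr (integral _ _ _); apply/esym/setIidl => z /=; rewrite !in_itv /= andbT.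
  by move=> /andP[xz _]; apply: ltW; apply: le_lt_trans xz.
rewrite EFinB -!density_cdfE.
have -> : X @^-1` `]x, y] = X @^-1` `]-oo, y] `\` X @^-1` `]-oo, x].
  apply/seteqP; split => t /=; rewrite !in_itv /=.
    by move=> /andP[xX ->]; split => //; apply/negP; rewrite -ltNge.
  by move=> [-> /negP]; rewrite -ltNge => ->.
rewrite measureD//.
- by rewrite setIidr// => t /=; rewrite !in_itv /= => /le_trans; exact.
- exact: measurable_funPTI.
- exact: measurable_funPTI.
- by rewrite (le_lt_trans (probability_le1 _ _))// ?ltry//; exact: measurable_funPTI.
Qed.

Lemma density_cdf_nd (x y : R) : x <= y -> density_cdf x <= density_cdf y.
Proof.
move=> xy; rewrite -lee_fin -!density_cdfE le_measure ?inE//;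
  try exact: measurable_funPTI.
by move=> t /=; rewrite !in_itv /= => /le_trans; exact.
Qed.

Lemma density_cdf_lipschitz : exists2 M : R, 0 < M &
  forall x y, x <= y -> density_cdf y - density_cdf x <= M * (y - x).
Proof.
have [M M0 fM] := density_bounded; exists M => //.
have main x y : 0 <= x -> x <= y -> density_cdf y - density_cdf x <= M * (y - x).
  move=> x0 xy; rewrite -lee_fin density_cdfB//.
  have sub : `]x, y] `<=` `]0%R, +oo[.
    by move=> z /=; rewrite !in_itv /= andbT => /andP[/(le_lt_trans x0)].
  apply: (@le_trans _ _ (\int[lebesgue_measure]_(z in `]x, y]) (cst M%:E z))%E).
    apply: ge0_le_integral => //.
    - by move=> z /sub /=; rewrite in_itv /= andbT => /ltW/density_gt0/ltW; rewrite lee_fin.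
    - by apply/measurable_EFinP; exact: measurable_density.
    - by move=> z /sub /=; rewrite in_itv /= andbT lee_fin => /fM.
  rewrite integral_cst//= lebesgue_measure_itv /= lte_fin.
  by case: ltP => _; rewrite ?mule0 ?lee_fin ?mulr_ge0 ?subr_ge0// ltW.
move=> x y xy; have [x0|x0] := leP 0 x; first exact: main.
have [y0|y0] := leP y 0.
  by rewrite !density_cdf_le0 ?subrr ?mulr_ge0 ?subr_ge0// ltW.
rewrite (density_cdf_le0 (ltW x0)) -(density_cdf_le0 (lexx 0)).
by apply: le_trans (main _ _ (lexx 0) (ltW y0)) _; rewrite ler_wpM2l ?lerD2l ?lerN2 ?ltW.
Qed.

(** The density is bounded below by a positive constant on [(x+y)/2, y]; the
    midpoint keeps the segment away from 0, where continuity is not assumed. *)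
Lemma density_cdf_lt (x y : R) : 0 <= x -> x < y -> density_cdf x < density_cdf y.
Proof.
move=> x0 xy; pose z := (x + y) / 2.
have xz : x < z by rewrite /z; lra.
have zy : z < y by rewrite /z; lra.
apply: le_lt_trans (density_cdf_nd (ltW xz)) _.
have z0 : 0 < z by exact: le_lt_trans xz.
have [c cin hc] := EVT_min (ltW zy) (@density_within_continuous z y z0).
have fc0 : 0 < f c.
  by apply: density_gt0; move: cin; rewrite in_itv /= => /andP[+ _]; apply: le_trans (ltW z0).
rewrite -subr_gt0; apply: (@lt_le_trans _ _ (f c * (y - z))).
  by rewrite mulr_gt0// subr_gt0.
rewrite -lee_fin (density_cdfB (ltW z0) (ltW zy)).
apply: (@le_trans _ _ (\int[lebesgue_measure]_(u in `]z, y]) (cst (f c)%:E u))%E).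
  by rewrite integral_cst//= lebesgue_measure_itv /= lte_fin zy.
have sub : `]z, y] `<=` `]0%R, +oo[.
  by move=> u /=; rewrite !in_itv /= andbT => /andP[/(lt_trans z0)].
apply: ge0_le_integral => //.
- by move=> u _; rewrite lee_fin ltW.
- by apply/measurable_EFinP; exact: measurable_density.
- move=> u /= uzy; rewrite lee_fin; apply: hc; move: uzy.
  by rewrite !in_itv /= => /andP[/ltW -> ->].
Qed.

Lemma density_cdf_lt1 (x : R) : density_cdf x < 1.
Proof.
have [x0|/ltW x0] := leP 0 x.
  by apply: lt_le_trans (density_cdf_le1 (x + 1)); apply: density_cdf_lt => //; rewrite ltrDl.
by rewrite density_cdf_le0.
Qed.

Lemma density_cdf_continuous : continuous density_cdf.
Proof.
have [M M0 ML] := density_cdf_lipschitz.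
have Mdist x y : `|density_cdf x - density_cdf y| <= M * `|x - y|.
  wlog xy : x y / x <= y => [hw|].
    have [/hw//|/ltW/hw] := leP x y.
    by rewrite distrC [in leRHS]distrC.
  rewrite distrC [in leRHS]distrC ger0_norm ?subr_ge0 ?density_cdf_nd//.
  by rewrite ger0_norm ?subr_ge0// ML.
move=> x; apply/cvgrPdist_lt => e e0; near=> y.
apply: le_lt_trans (Mdist x y) _; rewrite mulrC -ltr_pdivlMr//.
by near: y; apply: cvgr_dist_lt => //; exact: divr_gt0.
Unshelve. all: by end_near. Qed.

Lemma density_cdf_near1 (v : R) : v < 1 -> exists b, v < density_cdf b.
Proof.
move=> v1.
have : \forall x \near +oo, (v%:E < cdf X x)%E.
  have := @cvg_cdfy1 _ _ _ P X (fun u => (v%:E < u)%E); apply.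
  by apply: (open_ereal_gt' (x := 1%:E)); rewrite lte_fin.
move=> [b [_ hb]]; exists (b + 1); rewrite -lte_fin -density_cdfE.
by apply: hb; rewrite ltrDl.
Qed.

(** The probability integral transform: by continuity [v] is a value [F s], and
    [F X <= F s] means [X <= s] since [F] is strictly increasing. *)
Lemma density_cdf_uniform (v : R) : 0 <= v < 1 ->
  P [set t | density_cdf (X t) <= v] = v%:E.
Proof.
move=> /andP[v0 v1]; have [b vb] := density_cdf_near1 v1.
have b0 : 0 < b.
  by rewrite ltNge; apply/negP => /density_cdf_le0; move: vb => /[swap] ->; rewrite ltNge v0.
have [s s0b Fs] : exists2 s, s \in `[0, b]%R & density_cdf s = v.
  apply: IVT => //; first exact: ltW.
    by apply: continuous_subspaceT; exact: density_cdf_continuous.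
  by rewrite minEle maxEle density_cdf_nd ?(ltW b0)// density_cdf_le0// v0 ltW.
move: s0b; rewrite in_itv /= => /andP[s0 sb].
rewrite -Fs -density_cdfE; congr (P _); apply/seteqP; split => t /=; rewrite in_itv /=.
  by move=> h; rewrite leNgt; apply/negP => /(density_cdf_lt s0); rewrite ltNge h.
exact: density_cdf_nd.
Qed.

Lemma density_cdf_regular : exists M, regular_cdf density_cdf M.
Proof.
have [M M0 ML] := density_cdf_lipschitz; exists M; split => //.
- exact: density_cdf_nd.
- exact: density_cdf_le0.
- exact: density_cdf_lt.
- exact: density_cdf_lt1.
- exact: density_cdf_near1.
Qed.

End random_variable.
End density.

(** * The monotone coupling of one weight *)

(** On the scale of quantiles, the distribution function of the law with density
    1 - e on [0, 1/2] and 1 + e on [1/2, 1]. *)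
Definition shrink {R : realType} (e v : R) : R := v - e * Num.min v (1 - v).

(** The quantile function of the tilted law, whose distribution function is
    [shrink e \o F], evaluated at the quantile [F z]. *)
Definition boost {R : realType} (F : R -> R) (e z : R) : R :=
  inf [set x | 0 <= x /\ F z <= shrink e (F x)].

Definition lower_half {R : realType} (F : R -> R) : set R := [set z | F z <= 2^-1].

Section boost.
Context {R : realType} (F : R -> R) (M : R) (rF : regular_cdf F M).
Context (e : R) (e0 : 0 <= e) (e1 : e <= 1).

Lemma rcdf_ge0 (x : R) : 0 <= F x.
Proof.
have [x0|/ltW x0] := leP x 0; first by rewrite (rcdf_le0 rF).
by rewrite -(rcdf_le0 rF (lexx 0)) (rcdf_nd rF).
Qed.

(** The tent [min (v, 1 - v)] is 1-Lipschitz, so for e <= 1 subtracting e times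
    it neither reverses the order nor more than doubles differences. *)
Lemma tent_lip (a b : R) : a <= b ->
  `|e * Num.min b (1 - b) - e * Num.min a (1 - a)| <= b - a.
Proof.
move=> ab; rewrite -mulrBr normrM ger0_norm//.
apply: le_trans (ler_piMl (normr_ge0 _) e1) _; rewrite ler_norml.
by case: (leP a (1 - a)) => ?; case: (leP b (1 - b)) => ?; apply/andP; split; lra.
Qed.

Lemma shrink_nd (a b : R) : a <= b -> shrink e a <= shrink e b.
Proof. by move=> /tent_lip; rewrite ler_norml /shrink => /andP[]; lra. Qed.

Lemma shrink_lip (a b : R) : a <= b -> shrink e b - shrink e a <= 2 * (b - a).
Proof. by move=> /tent_lip; rewrite ler_norml /shrink => /andP[]; lra. Qed.

Lemma shrink_le (a : R) : 0 <= a <= 1 -> shrink e a <= a.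
Proof. by move=> /andP[? ?]; rewrite /shrink gerBl mulr_ge0// le_min; lra. Qed.

(** [shrink e v >= 2 * v - 1], and [F] takes values arbitrarily close to 1. *)
Lemma boost_set_nonempty (z : R) : [set x | 0 <= x /\ F z <= shrink e (F x)] !=set0.
Proof.
have [|b hb] := @rcdf_near1 _ _ _ rF ((1 + F z) / 2); first by have := rcdf_lt1 rF z; lra.
exists (Num.max b 0); split; first by rewrite le_max lexx orbT.
have hF : F b <= F (Num.max b 0) by rewrite (rcdf_nd rF)// le_max lexx.
set v := F (Num.max _ _) in hF *.
have v1 : v < 1 := rcdf_lt1 rF _.
have m1 : Num.min v (1 - v) <= 1 - v by rewrite ge_min lexx orbT.
rewrite /shrink; have : e * Num.min v (1 - v) <= 1 - v.
  by apply: le_trans (ler_wpM2l e0 m1) _; rewrite ler_piMl// subr_ge0 ltW.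
by move: hb; lra.
Qed.

Lemma boost_ge0 (z : R) : 0 <= boost F e z.
Proof. by apply: lb_le_inf; [exact: boost_set_nonempty|move=> x []]. Qed.

(** The Galois connection that characterizes a quantile function; the direct
    implication uses the continuity of [shrink e \o F] from the right. *)
Lemma boost_le (z x : R) : 0 <= x -> (boost F e z <= x) = (F z <= shrink e (F x)).
Proof.
move=> x0; apply/idP/idP; last first.
  by move=> h; apply: ge_inf; [exists 0 => y []|].
apply: contraTT; rewrite -!ltNge => h; have M0 := rcdf_M_gt0 rF.
(* [shrink e \o F] is (2 * M)-Lipschitz, so it is still below [F z] at [y]. *)
pose y := x + (F z - shrink e (F x)) / (4 * M).
have xy : x < y by rewrite /y ltrDl divr_gt0 ?subr_gt0// mulr_gt0.
apply: lt_le_trans xy _; apply: lb_le_inf; first exact: boost_set_nonempty.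
move=> u [u0 hu]; rewrite leNgt; apply/negP => uy.
have h1 : shrink e (F u) <= shrink e (F y) by rewrite shrink_nd// (rcdf_nd rF)// ltW.
have xy : x <= y by apply/ltW; rewrite /y ltrDl divr_gt0 ?subr_gt0// mulr_gt0.
have h2 := shrink_lip (rcdf_nd rF xy).
have h3 := rcdf_lipschitz rF xy.
have h4 : M * (y - x) = (F z - shrink e (F x)) / 4.
  by rewrite /y addrC addKr; field; rewrite gt_eqF.
by rewrite h4 in h3; lra.
Qed.

(** [shrink e (F x) <= F x] and [F] is strictly increasing. *)
Lemma boost_ge (z : R) : 0 <= z -> z <= boost F e z.
Proof.
move=> z0; apply: lb_le_inf; first exact: boost_set_nonempty.
move=> x [x0 hx]; rewrite leNgt; apply/negP => xz.
have := rcdf_lt rF x0 xz; rewrite ltNge => /negP; apply.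
by rewrite (le_trans hx)// shrink_le// rcdf_ge0 ltW// (rcdf_lt1 rF).
Qed.

(** Reaching quantile [F z] for the tilted law requires crossing a gap of mass
    [e * min (v, 1 - v) >= e * q / 2] under the original one, and [F] has slope
    at most [M]. *)
Lemma boost_gain (q z : R) : 0 <= z -> q <= F z <= 1 - q ->
  z + e * (q / (2 * M)) <= boost F e z.
Proof.
move=> z0 /andP[qz zq]; have M0 := rcdf_M_gt0 rF.
apply: lb_le_inf; first exact: boost_set_nonempty.
move=> x [x0 hx]; have zx : z <= x.
  by apply: le_trans (boost_ge z0) _; rewrite boost_le.
rewrite leNgt; apply/negP => xlt.
have ep : 0 < e.
  by rewrite lt_neqAle e0 andbT; apply/eqP => E; move: xlt; rewrite -E mul0r; lra.
have h1 := rcdf_nd rF zx; have h2 := rcdf_lipschitz rF zx.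
have h3 : M * (x - z) < e * q / 2.
  rewrite -ltr_pdivlMl//; have -> : M^-1 * (e * q / 2) = e * (q / (2 * M)).
    by field; rewrite gt_eqF.
  by lra.
have q0 : 0 < q.
  have : 0 < e * q / 2 by apply: le_lt_trans h3; rewrite mulr_ge0 ?subr_ge0// ltW.
  by rewrite -mulrA pmulr_rgt0//; lra.
have eq_le : e * q <= q by rewrite ler_piMl// ltW.
have hm : q / 2 <= Num.min (F x) (1 - F x) by rewrite le_min; apply/andP; split; lra.
have := ler_wpM2l e0 hm; move: hx; rewrite /shrink; lra.
Qed.

Lemma boost_preimage (x : R) : [set z | boost F e z <= x] =
  if 0 <= x then [set z | F z <= shrink e (F x)] else set0.
Proof.
case: (leP 0 x) => x0; first by apply/seteqP; split => z /=; rewrite boost_le.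
apply/seteqP; split => z //= h.
by have := le_lt_trans (le_trans (boost_ge0 z) h) x0; rewrite ltxx.
Qed.

Lemma measurable_rcdf : measurable_fun [set: R] F.
Proof.
by apply: nondecreasing_measurable => //= x y; exact: (rcdf_nd rF).
Qed.

Lemma measurable_rcdf_le (v : R) : measurable [set z | F z <= v].
Proof.
have -> : [set z | F z <= v] = F @^-1` `]-oo, v].
  by apply/seteqP; split => z /=; rewrite in_itv.
by rewrite -[X in measurable X]setTI; exact: measurable_rcdf.
Qed.

Lemma measurable_boost_le (x : R) : measurable [set z | boost F e z <= x].
Proof. by rewrite boost_preimage; case: ifP => // _; exact: measurable_rcdf_le. Qed.

Section law.
Context d (T : measurableType d) (P : probability T R) (X : {RV P >-> R}).
Context (PX : forall x, P (X @^-1` `]-oo, x]) = (F x)%:E).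
Context (PFX : forall v, 0 <= v < 1 -> P [set t | F (X t) <= v] = v%:E).

(** Both sides are [shrink e (F x)]: the left one by the Galois connection and
    uniformity of [F X], the right one by splitting at the median. *)
Lemma boost_law (x : R) :
  (P (X @^-1` [set z | (boost F e z <= x)%R]) =
  (1 - e)%:E * P (X @^-1` (`]-oo, x] `&` lower_half F)) +
  (1 + e)%:E * P (X @^-1` (`]-oo, x] `&` ~` lower_half F)))%E.
Proof.
have [x0|x0] := leP 0 x; last first.
  have P0 B : measurable B -> P (X @^-1` (`]-oo, x] `&` B)) = 0%E.
    move=> mB; apply/eqP; rewrite eq_le measure_ge0 andbT.
    apply: (@le_trans _ _ (P (X @^-1` `]-oo, x]))); last first.
      by rewrite PX (rcdf_le0 rF (ltW x0)).
    apply: le_measure; rewrite ?inE.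
    - by apply: measurable_funPTI; apply: measurableI.
    - exact: measurable_funPTI.
    - by move=> t [].
  have mL : measurable (lower_half F) by exact: measurable_rcdf_le.
  rewrite !P0 ?mule0 ?adde0 //; last exact: measurableC.
  by rewrite boost_preimage leNgt x0 /= preimage_set0 measure0.
rewrite boost_preimage x0.
have -> : P (X @^-1` [set z | F z <= shrink e (F x)]) = (shrink e (F x))%:E.
  rewrite -[X in P X]/[set t | F (X t) <= shrink e (F x)] PFX//.
  have Fx := rcdf_ge0 x; have Fx1 := rcdf_lt1 rF x.
  apply/andP; split; last by rewrite (le_lt_trans _ Fx1)// shrink_le// Fx ltW.
  have m0 : 0 <= Num.min (F x) (1 - F x) by rewrite le_min Fx subr_ge0 ltW.
  rewrite /shrink subr_ge0 (le_trans (ler_piMl m0 e1))//.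
  by rewrite ge_min lexx.
have [Fx|Fx] := leP (F x) 2^-1.
  have -> : `]-oo, x] `&` lower_half F = `]-oo, x]%classic.
    by apply/setIidl => z /=; rewrite in_itv /= => /(rcdf_nd rF)/le_trans; apply.
  have -> : `]-oo, x] `&` ~` lower_half F = set0.
    apply/seteqP; split => z //= [] /=; rewrite in_itv /= => /(rcdf_nd rF) h.
    by apply; exact: le_trans Fx.
  rewrite preimage_set0 measure0 mule0 adde0 PX -EFinM /shrink; congr EFin.
  by rewrite min_l; lra.
have sub : lower_half F `<=` `]-oo, x]%classic.
  move=> z hz /=; rewrite in_itv /= leNgt; apply/negP => /ltW/(rcdf_nd rF) h.
  by have := lt_le_trans Fx (le_trans h hz); rewrite ltxx.
have Plow : P (X @^-1` lower_half F) = (2^-1)%:E.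
  by rewrite -[X in P X]/[set t | F (X t) <= 2^-1] PFX//; lra.
rewrite setIidr// Plow.
have -> : X @^-1` (`]-oo, x] `&` ~` lower_half F) =
    X @^-1` `]-oo, x] `\` X @^-1` lower_half F by [].
rewrite measureD; last 3 first.
- exact: measurable_funPTI.
- by apply: measurable_funPTI; exact: measurable_rcdf_le.
- by rewrite -ge0_fin_numE// fin_num_measure//; exact: measurable_funPTI.
rewrite setIidr; last by move=> t; exact: sub.
transitivity ((1 - e)%:E * (2^-1)%:E + (1 + e)%:E * ((F x)%:E - (2^-1)%:E))%E.
  rewrite -EFinB -!EFinM -EFinD; congr EFin.
  by rewrite /shrink min_r; lra.
by congr (_ + _ * (_ - _))%E; apply/esym; [exact: PX|exact: Plow].
Qed.

End law.
End boost.

(** * Tilted measures *)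

Section tilt.
Context d (T : measurableType d) (R : realType) (P : probability T R)
  (I : eqType) (X : I -> {RV P >-> R}) (L : set R) (mL : measurable L).

Let mXL i : measurable (X i @^-1` L).
Proof. exact: measurable_funPTI. Qed.

Let mXLC i : measurable (X i @^-1` ~` L).
Proof. by apply: measurable_funPTI; exact: measurableC. Qed.

(** The measure with density the product over [i] in [S] of [lo i] where
    [X i] is in [L] and [hi i] elsewhere. Building it by restriction and scaling
    avoids integrals: each property is an induction on [S]. *)
Fixpoint tilt (lo hi : I -> {nonneg R}) (S : seq I) : {measure set T -> \bar R} :=
  if S is i :: S' then
    measure_add (mscale (lo i) (mrestr (tilt lo hi S') (mXL i)))
                (mscale (hi i) (mrestr (tilt lo hi S') (mXLC i)))
  else P.

Lemma tilt_cons lo hi i S A :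
  (tilt lo hi (i :: S) A = (lo i)%:num%:E * tilt lo hi S (A `&` X i @^-1` L) +
    (hi i)%:num%:E * tilt lo hi S (A `&` X i @^-1` ~` L))%E.
Proof. exact: measure_addE. Qed.

Definition sq_weight (c : I -> {nonneg R}) (i : I) : {nonneg R} :=
  ((c i)%:num ^+ 2)%:nng.

(** The Cauchy-Schwarz inequality between the density and the indicator of [A],
    in the linearized form a * r <= (a * r)^2 / (4 * K) + K. This form, with the
    free scalar [a], passes through each splitting of [A] by an [X i]. *)
Lemma tilt_sq_le (lo hi : I -> {nonneg R}) (S : seq I) (K a : R) (A : set T) :
  0 < K -> 0 <= a -> measurable A ->
  (a%:E * tilt lo hi S A <=
   (a ^+ 2 / (4 * K))%:E * tilt (sq_weight lo) (sq_weight hi) S A + K%:E * P A)%E.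
Proof.
move=> K0; elim: S a A => [|i S IH] a A a0 mA.
  rewrite /= -ge0_muleDl ?lee_fin ?divr_ge0 ?sqr_ge0 ?mulr_ge0 ?(ltW K0)//.
  apply: lee_wpmul2r => //; rewrite -EFinD lee_fin -subr_ge0.
  have -> : a ^+ 2 / (4 * K) + K - a = (a - 2 * K) ^+ 2 / (4 * K).
    by field; rewrite gt_eqF.
  by rewrite divr_ge0 ?sqr_ge0// mulr_ge0// ltW.
rewrite !tilt_cons.
have mA1 : measurable (A `&` X i @^-1` L) by exact: measurableI.
have mA2 : measurable (A `&` X i @^-1` ~` L) by exact: measurableI.
have PA : P A = (P (A `&` X i @^-1` L) + P (A `&` X i @^-1` ~` L))%E.
  rewrite -measureU//; first by rewrite -setIUr -preimage_setU setUv preimage_setT setIT.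
  by apply/seteqP; split => t //= [[_ tL] [_ nL]]; exact: nL tL.
have lo0 : 0 <= (lo i)%:num by [].
have hi0 : 0 <= (hi i)%:num by [].
have := IH (a * (lo i)%:num) _ (mulr_ge0 a0 lo0) mA1.
have := IH (a * (hi i)%:num) _ (mulr_ge0 a0 hi0) mA2.
move=> h2 h1; have := leeD h1 h2.
rewrite PA /=; set u1 := tilt lo hi S _; set u2 := tilt lo hi S _.
set v1 := tilt _ _ S _; set v2 := tilt _ _ S _; set p1 := P _; set p2 := P _.
have u10 : (0 <= u1)%E by exact: measure_ge0.
have u20 : (0 <= u2)%E by exact: measure_ge0.
have v10 : (0 <= v1)%E by exact: measure_ge0.
have v20 : (0 <= v2)%E by exact: measure_ge0.
have p10 : (0 <= p1)%E by exact: measure_ge0.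
have p20 : (0 <= p2)%E by exact: measure_ge0.
have le0 (c : R) (v : \bar R) : 0 <= c -> (0 <= v -> 0 <= c%:E * v)%E.
  by move=> c0 v0; rewrite mule_ge0// lee_fin.
have c0 : 0 <= a ^+ 2 / (4 * K) by rewrite divr_ge0 ?sqr_ge0// mulr_ge0// ltW.
rewrite !ge0_muleDr ?le0// !muleA -!EFinM => /le_trans; apply.
rewrite addeACA !exprMn.
by rewrite !(mulrAC (a ^+ 2) _ (4 * K)^-1).
Qed.

Definition box_event (s : seq I) (B : I -> set R) : set T :=
  \bigcap_(i in [set` s]) (X i @^-1` B i).

Context (X_indep : mutually_independent X).

(** Under the tilted measure the variables remain independent; each splitting
    only refines the constraint on one coordinate. *)
Lemma tilt_box_event (lo hi : I -> {nonneg R}) (S s : seq I) (B : I -> set R) :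
  uniq S -> uniq s -> {subset S <= s} -> (forall i, measurable (B i)) ->
  (tilt lo hi S (box_event s B) = \prod_(i <- s)
    (if i \in S then (lo i)%:num%:E * P (X i @^-1` (B i `&` L)) +
                     (hi i)%:num%:E * P (X i @^-1` (B i `&` ~` L))
     else P (X i @^-1` B i)))%E.
Proof.
elim: S B => [|j S IH] B; first by move=> _ us _ mB; rewrite /= X_indep.
move=> /= /andP[jS uS] us Ss mB.
have js : j \in s by rewrite Ss// mem_head.
pose upd C i := if i == j then B i `&` C else B i.
have rect_upd C : box_event s B `&` X j @^-1` C = box_event s (upd C).
  apply/seteqP; split => [t [tB tC] i /= si|t tB].
    rewrite /upd; case: eqVneq => [->|_]; last exact: tB.
    by split => //; exact: tB.
  split; last by have := tB _ js; rewrite /upd /= eqxx => -[].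
  by move=> i si; have := tB _ si; rewrite /upd; case: eqVneq => // _ [].
have mupd C : measurable C -> forall i, measurable (upd C i).
  by move=> mC i; rewrite /upd; case: eqVneq => // _; exact: measurableI.
have prodE C : measurable C ->
    (tilt lo hi S (box_event s (upd C)) = P (X j @^-1` (B j `&` C)) *
    \prod_(i <- s | i != j)
      (if i \in j :: S then (lo i)%:num%:E * P (X i @^-1` (B i `&` L)) +
                            (hi i)%:num%:E * P (X i @^-1` (B i `&` ~` L))
       else P (X i @^-1` B i)))%E.
  move=> mC; rewrite IH//; last 2 first.
  - by move=> i iS; rewrite Ss// inE iS orbT.
  - exact: mupd.
  rewrite (bigD1_seq j)//= (negPf jS) /upd eqxx; congr (_ * _)%E.
  by apply: eq_bigr => i /negPf ij; rewrite ij inE ij.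
rewrite -[LHS]/(tilt lo hi (j :: S) _) tilt_cons !rect_upd.
rewrite !prodE//; last exact: measurableC.
rewrite (bigD1_seq j)//= mem_head !muleA -ge0_muleDl//; exact: mule_ge0.
Qed.

End tilt.

(** * The joint law of the increased weights *)

Section cylinders.
Context {R : realType} (I : eqType).

(** Lower orthants in finitely many coordinates: a class closed under
    intersection that generates the product sigma-algebra. *)
Definition cylinders : set (set (I -> R)) :=
  [set A | exists (s : seq I) (a : I -> R),
     A = [set z | forall i, i \in s -> z i <= a i]].

Definition configuration := g_sigma_algebraType cylinders.

Lemma cylinders_setI : setI_closed cylinders.
Proof.
move=> _ _ [s [a ->]] [s' [a' ->]].
exists (s ++ s'), (fun i => if i \in s then
  (if i \in s' then Num.min (a i) (a' i) else a i) else a' i).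
apply/seteqP; split => [z [/= za za'] i|z /= h].
  rewrite mem_cat; case: (boolP (i \in s)) => si /=; last exact: za'.
  by case: (boolP (i \in s')) => si' _; rewrite ?le_min za// za'.
split => i si; have := h i; rewrite mem_cat si ?orbT => /(_ isT).
  by case: ifP => // _; rewrite le_min => /andP[].
by case: ifP => // _; rewrite le_min => /andP[].
Qed.

Lemma measurable_coordinate (i : I) :
  measurable_fun [set: configuration] (fun z : configuration => z i).
Proof.
apply: (measurability _ (RGenOInfty.measurableE R)).
move=> _ [_ [r ->] <-]; rewrite setTI.
have -> : (fun z : configuration => z i) @^-1` `]r, +oo[ =
    ~` [set z : I -> R | forall j, j \in [:: i] -> z j <= r].
  apply/seteqP; split => z /=; rewrite in_itv /= andbT.
    by move=> rz /(_ i); rewrite mem_head => /(_ isT); rewrite leNgt rz.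
  move=> h; rewrite ltNge; apply/negP => zr; apply: h => j.
  by rewrite inE => /eqP ->.
apply: measurableC; apply: sub_sigma_algebra.
by exists [:: i], (fun=> r).
Qed.

Lemma measurable_configuration d (T : measurableType d) (W : T -> I -> R) :
  (forall (s : seq I) (a : I -> R),
     measurable [set t | forall i, i \in s -> W t i <= a i]) ->
  measurable_fun [set: T] (W : T -> configuration).
Proof.
move=> h; apply: (@measurability _ _ T configuration setT W cylinders erefl).
by move=> _ [_ [s [a ->]] <-]; rewrite setTI; exact: h.
Qed.

End cylinders.

Section joint_law.
Context d (T : measurableType d) (R : realType) (P : probability T R)
  (I : eqType) (X : I -> {RV P >-> R}) (X_indep : mutually_independent X)
  (F : R -> R) (M : R) (rF : regular_cdf F M)
  (PX : forall i x, P (X i @^-1` `]-oo, x]) = (F x)%:E)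
  (PFX : forall i v, 0 <= v < 1 -> P [set t | F (X i t) <= v] = v%:E)
  (eps : I -> R) (eps_ge0 : forall i, 0 <= eps i) (eps_le1 : forall i, eps i <= 1)
  (S : seq I) (uS : uniq S).

Let mL : measurable (lower_half F).
Proof. exact: (measurable_rcdf_le rF). Qed.

Lemma one_sub_eps_ge0 i : 0 <= 1 - eps i. Proof. by rewrite subr_ge0. Qed.
Lemma one_add_eps_ge0 i : 0 <= 1 + eps i. Proof. by rewrite addr_ge0. Qed.

Definition lo_weight i : {nonneg R} := NngNum (one_sub_eps_ge0 i).
Definition hi_weight i : {nonneg R} := NngNum (one_add_eps_ge0 i).

Definition tilted : {measure set T -> \bar R} := tilt X mL lo_weight hi_weight S.

Definition boosted (t : T) (i : I) : R :=
  if i \in S then boost F (eps i) (X i t) else X i t.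

Lemma prob_lower_half i : P (X i @^-1` lower_half F) = (2^-1)%:E.
Proof. by rewrite -[X in P X]/[set t | F (X i t) <= 2^-1] PFX//; lra. Qed.

Lemma prob_upper_half i : P (X i @^-1` ~` lower_half F) = (2^-1)%:E.
Proof.
rewrite -[LHS]/(P (~` (X i @^-1` lower_half F))) probability_setC;
  last exact: (measurable_funPTI (X i) mL).
by rewrite prob_lower_half -EFinB; congr EFin; lra.
Qed.

Let ray (s : seq I) (a : I -> R) (i : I) : set R :=
  if i \in s then `]-oo, a i]%classic else setT.

Let mray s a i : measurable (ray s a i).
Proof. by rewrite /ray; case: ifP. Qed.

Let bray (s : seq I) (a : I -> R) (i : I) : set R :=
  if i \in S then (fun z => boost F (eps i) z) @^-1` ray s a i else ray s a i.

Let mbray s a i : measurable (bray s a i).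
Proof.
rewrite /bray; case: ifP => _; last exact: mray.
rewrite /ray; case: ifP => _; last by rewrite preimage_setT.
rewrite (_ : _ @^-1` _ = [set z | boost F (eps i) z <= a i]); last first.
  by apply/seteqP; split => z /=; rewrite in_itv.
exact: (measurable_boost_le rF).
Qed.

Let cylE s a : (fun t i => X i t) @^-1` [set z | forall i, i \in s -> z i <= a i] =
  box_event X (undup (s ++ S)) (ray s a).
Proof.
apply/seteqP; split => t /= h i.
  by rewrite /= /ray; case: ifP => // si _; rewrite /= in_itv /= h.
move=> si; have := h i; rewrite /= mem_undup mem_cat si => /(_ isT).
by rewrite /ray si /= in_itv.
Qed.

Let bcylE s a : boosted @^-1` [set z | forall i, i \in s -> z i <= a i] =
  box_event X (undup (s ++ S)) (bray s a).
Proof.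
apply/seteqP; split => t /= h i.
  rewrite /= /bray /ray; case: (boolP (i \in s)) => si _.
    by have := h i si; rewrite /boosted; case: ifP => _ /=; rewrite in_itv.
  by case: ifP.
move=> si; have := h i; rewrite /= mem_undup mem_cat si => /(_ isT).
by rewrite /bray /ray si /boosted; case: ifP => _ /=; rewrite in_itv.
Qed.

Let measurable_rect s B : (forall i, measurable (B i)) -> measurable (box_event X s B).
Proof.
move=> mB; by apply: fin_bigcap_measurable => // i _; exact: measurable_funPTI.
Qed.

Lemma measurable_sample :
  measurable_fun [set: T] ((fun t i => X i t) : T -> configuration I).
Proof.
apply: measurable_configuration => s a; have := cylE s a.
by rewrite /preimage /= => ->; exact: measurable_rect.
Qed.

Lemma measurable_boosted : measurable_fun [set: T] (boosted : T -> configuration I).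
Proof.
apply: measurable_configuration => s a; have := bcylE s a.
by rewrite /preimage /= => ->; exact: measurable_rect.
Qed.

(** Both sides factor over the coordinates, and the factors agree by
    [boost_law]. *)
Lemma boosted_law_cylinder (A : set (I -> R)) : cylinders A ->
  P (boosted @^-1` A) = tilted ((fun t i => X i t) @^-1` A).
Proof.
move=> [s [a ->]]; rewrite cylE bcylE.
rewrite /tilted tilt_box_event//; last 2 first.
- exact: undup_uniq.
- by move=> i iS; rewrite mem_undup mem_cat iS orbT.
rewrite X_indep ?undup_uniq//; apply: eq_bigr => i _.
rewrite /bray; case: ifP => // iS; rewrite /ray; case: ifP => _; last first.
  rewrite !setTI prob_lower_half prob_upper_half -[X in P X]/[set: T].
  by rewrite probability_setT -!EFinM -EFinD; congr EFin => /=; lra.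
rewrite -(boost_law rF (eps_ge0 i) (eps_le1 i) (PX i) (@PFX i)).
by congr (P _); apply/seteqP; split => t /=; rewrite in_itv.
Qed.

(** The orthants are closed under intersection and generate the sigma-algebra,
    so agreement on them suffices. *)
Lemma boosted_law (A : set (configuration I)) : measurable A ->
  P (boosted @^-1` A) = tilted ((fun t i => X i t) @^-1` A).
Proof.
move=> mA.
pose m1 : {measure set (configuration I) -> \bar R} :=
  measure_function_pushforward__canonical__measure_function_Measure P
    measurable_boosted.
pose m2 : {measure set (configuration I) -> \bar R} :=
  measure_function_pushforward__canonical__measure_function_Measure tilted
    measurable_sample.
rewrite -[LHS]/(m1 A) -[RHS]/(m2 A).
apply: (@measure_unique _ R (configuration I) (@cylinders R I) (fun=> setT) erefl
  (@cylinders_setI R I) _ _ m1 m2) => //.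
- move=> _; exists [::], (fun=> 0).
  by apply/seteqP; split => z //= _ i.
- by rewrite bigcup_const//; exists 0%N.
- exact: boosted_law_cylinder.
- by move=> _; rewrite -[X in (X < _)%E]/(P [set: T]) probability_setT ltry.
Qed.

(** With weights squared, the total mass is the product of
    ((1 - eps)^2 + (1 + eps)^2) / 2 = 1 + eps^2. *)
Lemma tilted_le (K : R) (A : set T) : 0 < K -> measurable A ->
  (tilted A <= (4 * K)^-1%:E * (\prod_(i <- S) (1 + eps i ^+ 2))%:E + K%:E * P A)%E.
Proof.
move=> K0 mA.
have := @tilt_sq_le _ T R P I X _ mL lo_weight hi_weight S K 1 A K0 ler01 mA.
rewrite mul1e => /le_trans; apply; apply: leeD2r.
rewrite expr1n mul1r; apply: lee_wpmul2l; first by rewrite lee_fin invr_ge0 mulr_ge0// ltW.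
set m := tilt _ _ _ _ _.
have mA_T : (m A <= m setT)%E by apply: le_measure; rewrite ?inE.
apply: (le_trans mA_T).
have -> : [set: T] = box_event X S (fun=> setT).
  by apply/esym; rewrite /box_event; apply/seteqP; split => t // _ i.
rewrite tilt_box_event// -prodEFin le_eqVlt; apply/orP; left; apply/eqP.
rewrite big_seq [RHS]big_seq; apply: eq_bigr => i iS; rewrite iS !setTI.
rewrite prob_lower_half prob_upper_half -!EFinM -EFinD; congr EFin => /=.
by field.
Qed.

End joint_law.

(** * Counting self-avoiding paths *)

Lemma measure_bigsetU_le d (T : measurableType d) (R : realType)
    (mu : {measure set T -> \bar R}) (J : Type) (s : seq J) (A : J -> set T) :
  (forall j, measurable (A j)) ->
  (mu (\big[setU/set0]_(j <- s) A j) <= \sum_(j <- s) mu (A j))%E.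
Proof.
move=> mA; elim: s => [|j s IH]; first by rewrite !big_nil measure0.
rewrite !big_cons; apply: le_trans (leeD2l _ IH).
by apply: measureU2 => //; exact: bigsetU_measurable.
Qed.

Lemma prode_le_expn (R : realType) (J : Type) (s : seq J) (g : J -> \bar R) (c : R) :
  (forall j, 0 <= g j <= c%:E)%E ->
  (0 <= \prod_(j <- s) g j <= (c ^+ size s)%:E)%E.
Proof.
move=> gc; elim: s => [|j s /andP[IH0 IH]]; first by rewrite big_nil expr0 lexx lee_fin ler01.
have /andP[g0 g1] := gc j.
by rewrite big_cons mule_ge0//= exprS EFinM lee_pmul.
Qed.

(** Steps are coded by an axis and a sign, so that paths of length [m] from a
    point become a finite type with [4 ^ m] elements. *)
Definition neighbor (u : vertex) (k : bool * bool) : vertex :=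
  if k.1 then (u.1 + (-1) ^+ k.2, u.2) else (u.1, u.2 + (-1) ^+ k.2).

Lemma adjacent_neighbor (u v : vertex) : adjacent u v -> exists k, neighbor u k = v.
Proof.
case: u v => [a b] [c d]; rewrite /adjacent /neighbor /= => /eqP h.
have [bd|bd] := eqVneq b d.
  by exists (true, c < a); case: (ltP c a) => ? /=; congr (_, _); rewrite ?expr1 ?expr0; lia.
by exists (false, d < b); case: (ltP d b) => ? /=; congr (_, _); rewrite ?expr1 ?expr0; lia.
Qed.

Lemma path_scanl_neighbor (u : vertex) (p : seq vertex) : path adjacent u p ->
  exists2 l, size l = size p & scanl neighbor u l = p.
Proof.
elim: p u => [|v p IH] u /=; first by exists [::].
move=> /andP[/adjacent_neighbor[k <-] /IH[l sl lE]].
by exists (k :: l); rewrite /= ?sl ?lE.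
Qed.

Section peierls.
Context d (T : measurableType d) (R : realType) (P : probability T R)
  (w : edge -> {RV P >-> R}) (w_indep : mutually_independent w)
  (B : set R) (mB : measurable B)
  (PB : forall e, (P (w e @^-1` B) <= ((64^-1 : R) ^+ 2)%:E)%E).

(** A path of length [m] together with a guess of which of its edges are bad. *)
Definition pattern (m : nat) : finType := (m.-tuple (bool * bool) * m.-tuple bool)%type.

Definition pattern_edges (x : vertex) (m : nat) (c : pattern m) : seq edge :=
  pairmap edge_of x (scanl neighbor x c.1).

(** The guessed edges are bad. Patterns that reuse an edge or guess fewer than
    half of the edges are discarded, since only the others can violate
    [few_bad_edges]. *)
Definition pattern_event (x : vertex) (m : nat) (c : pattern m) : set T :=
  let E := pattern_edges x c in
  if uniq E && (m <= 2 * size (mask c.2 E))%N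
  then \bigcap_(e in [set` mask c.2 E]) (w e @^-1` B) else set0.

Lemma measurable_pattern_event x m (c : pattern m) : measurable (pattern_event x c).
Proof.
rewrite /pattern_event; case: ifP => // _.
by apply: fin_bigcap_measurable => // e _; exact: measurable_funPTI.
Qed.

(** At least [m / 2] distinct edges are required to be bad, each with probability
    at most the square of 1/64. *)
Lemma pattern_event_le x m (c : pattern m) :
  (P (pattern_event x c) <= ((64^-1 : R) ^+ m)%:E)%E.
Proof.
rewrite /pattern_event; case: ifP => [/andP[uE mE]|_]; last first.
  by rewrite measure0 lee_fin exprn_ge0// invr_ge0.
rewrite (w_indep (B := fun=> B)) ?mask_uniq//.
have PB' e : (0 <= P (w e @^-1` B) <= ((64^-1 : R) ^+ 2)%:E)%E.
  by rewrite measure_ge0 PB.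
have /andP[_ h] := prode_le_expn (mask c.2 (pattern_edges x c)) PB'.
apply: (le_trans h); rewrite lee_fin -exprM; apply: ler_wiXn2l => //.
by rewrite invf_le1// ler1n.
Qed.

Definition bad_paths (x : vertex) (m : nat) : set T :=
  \big[setU/set0]_(c <- enum (pattern m)) pattern_event x c.

Lemma measurable_bad_paths x m : measurable (bad_paths x m).
Proof. by apply: bigsetU_measurable => c _; exact: measurable_pattern_event. Qed.

(** There are [8 ^ m] patterns of probability at most [64 ^- m]. *)
Lemma bad_paths_le x m : (P (bad_paths x m) <= ((8^-1 : R) ^+ m)%:E)%E.
Proof.
apply: (le_trans (measure_bigsetU_le _ _ _)).
  by move=> c; exact: measurable_pattern_event.
apply: (@le_trans _ _ (\sum_(c <- enum (pattern m)) ((64^-1 : R) ^+ m)%:E)%E).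
  by apply: lee_sum => c _; exact: pattern_event_le.
rewrite sumEFin lee_fin big_enum /= sumr_const card_prod !card_tuple card_prod card_bool.
rewrite -[leLHS]mulr_natl natrM !natrX -!exprMn.
by apply: lerXn2r; rewrite ?nnegrE; lra.
Qed.

Definition bad_before (x : vertex) (n : nat) : set T :=
  \big[setU/set0]_(m <- iota 1 n) bad_paths x m.

Lemma measurable_bad_before x n : measurable (bad_before x n).
Proof. by apply: bigsetU_measurable => m _; exact: measurable_bad_paths. Qed.

Lemma bad_before_le x n : (P (bad_before x n) <= (7^-1 : R)%:E)%E.
Proof.
apply: (le_trans (measure_bigsetU_le _ _ _)); first by move=> c; exact: measurable_bad_paths.
apply: (@le_trans _ _ (\sum_(m <- iota 1 n) ((8^-1 : R) ^+ m)%:E)%E).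
  by apply: lee_sum => m _; exact: bad_paths_le.
rewrite sumEFin lee_fin -[iota 1 n]/(iota (1 + 0) n) iotaDl big_map.
rewrite -[X in iota 0 X]subn0 -/(index_iota 0 n).
(* The geometric series of ratio 1/8 without its first term sums to 1/7. *)
suff -> : \sum_(0 <= i < n) (8^-1 : R) ^+ (1 + i) = 7^-1 * (1 - 8^-1 ^+ n).
  by rewrite ler_piMr// gerBl exprn_ge0.
elim: n => [|n IH]; first by rewrite big_geq// expr0 subrr mulr0.
by rewrite big_nat_recr//= IH add1n exprS; set u := _ ^+ n; field.
Qed.

(** If the conclusion failed, the first [m] edges with the true set of bad ones
    would form a pattern whose event occurs. *)
Lemma few_bad_edges x n t (q : seq vertex) m : ~ bad_before x n t ->
  path adjacent x q -> uniq (x :: q) -> (n <= size q)%N -> (0 < m <= n)%N ->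
  (2 * count (fun e => w e t \in B) (take m (pairmap edge_of x q)) < m)%N.
Proof.
move=> good xq uq nq /andP[m0 mn]; rewrite ltnNge; apply/negP => many; apply: good.
set bad := fun e => _ in many.
have [l sl lE] := path_scanl_neighbor xq.
have E_ : pairmap edge_of x (scanl neighbor x (take m l)) = take m (pairmap edge_of x q).
  rewrite -lE; elim: (l) (x) (m) => [//|k l' IH] y [//|m'] /=.
  by rewrite IH.
have mq : (m <= size q)%N by exact: leq_trans nq.
have sl' : size (take m l) == m by rewrite size_takel// sl.
pose E := take m (pairmap edge_of x q).
have sb : size (map bad E) == m by rewrite size_map size_takel// size_pairmap.
pose c : pattern m := (Tuple sl', Tuple sb).
have cE : pattern_edges x c = E by [].
rewrite /bad_before -bigcup_seq.
exists m; first by rewrite /= mem_iota m0 add1n ltnS.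
rewrite /bad_paths -bigcup_seq; exists c; first by rewrite /= mem_enum.
rewrite /pattern_event cE take_uniq ?uniq_path_edges//= -filter_mask size_filter many.
move=> e /=; rewrite mem_filter => /andP[].
by rewrite /bad inE.
Qed.

End peierls.

(** * Anticoncentration of the passage time *)

(** Infima are compared path by path; the gain of an arbitrary path is bounded
    below by that of its loop erasure. *)
Lemma passage_time_ge_add (R : realType) (v v' : edge -> R) (x y : vertex) (D : R) :
  (forall e, 0 <= v e) -> (forall e, v e <= v' e) ->
  (forall q, path adjacent x q -> last x q = y -> uniq (x :: q) ->
     D <= path_weight (fun e => v' e - v e) x q) ->
  passage_time v x y + D <= passage_time v' x y.
Proof.
move=> v0 vv' hD; apply: lb_le_inf.
  by have [p xyp] := exists_path x y; exists (path_weight v' x p), p.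
move=> _ [p /andP[xp /eqP lp] <-].
have inc0 e : 0 <= v' e - v e by rewrite subr_ge0.
have [q [xq lq uq qp]] := loop_erasure inc0 xp.
have -> : path_weight v' x p = path_weight v x p + path_weight (fun e => v' e - v e) x p.
  by rewrite /path_weight -big_split; apply: eq_bigr => e _ /=; rewrite addrC subrK.
apply: lerD; last by apply: le_trans qp; apply: hD => //; rewrite lq.
apply: ge_inf; last by exists p => //; apply/andP; split => //; exact/eqP.
by exists 0 => _ [r _ <-]; exact: path_weight_ge0.
Qed.

(** Coordinates of a configuration are truncated at 0 because the measurability
    of the passage time is known for nonnegative weights; sampled weights are
    not affected. *)
Lemma measurable_passage_event (R : realType) (x y : vertex) (a b : R) :
  measurable [set z : configuration (R:=R) edge |
    a <= passage_time (fun e => Num.max (z e) 0) x y <= b].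
Proof.
(* Any probability will do: measurability does not depend on it. *)
pose Q : probability (configuration (R:=R) edge) R :=
  dirac ((fun=> 0) : configuration edge).
have mz e : measurable_fun [set: configuration (R:=R) edge]
    (fun z : configuration edge => Num.max (z e) 0).
  by apply: measurable_maxr => //; exact: measurable_coordinate.
pose X e : {RV Q >-> R} := mfun_Sub (mem_set (mz e)).
have X0 e z : 0 <= X e z by rewrite /= le_max lexx orbT.
have := measurable_passage_time X0 x y.
move=> /(_ measurableT `[a, b]%classic (measurable_itv _)); rewrite setTI.
by congr measurable; apply/seteqP; split => z /=; rewrite in_itv.
Qed.

Lemma le_l1_euclidean (R : realType) (x y : vertex) :
  euclidean_dist R x y <= (l1_dist x y)%:R.
Proof.
rewrite /euclidean_dist /l1_dist natrD !natr_absz.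
set i := x.1 - y.1; set j := x.2 - y.2.
rewrite !intr_norm; set u := i%:~R; set v := j%:~R.
rewrite -[leRHS]ger0_norm ?addr_ge0// -sqrtr_sqr ler_wsqrtr//.
rewrite sqrrD !real_normK ?num_real// lerD2r lerDl.
by rewrite mulrn_wge0// mulr_ge0.
Qed.

Section anticoncentration.
Context d (T : measurableType d) (R : realType) (P : probability T R)
  (w : edge -> {RV P >-> R}) (w_ge0 : forall e t, 0 <= w e t)
  (w_indep : mutually_independent w) (F : R -> R) (M : R) (rF : regular_cdf F M)
  (PX : forall e x, P (w e @^-1` `]-oo, x]) = (F x)%:E)
  (PFX : forall e v, 0 <= v < 1 -> P [set t | F (w e t) <= v] = v%:E)
  (x y : vertex) (xy : (0 < l1_dist x y)%N).

Let n := l1_dist x y.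
Let rH := Num.sqrt (harmonic_sum R n).

(** The two tails together then have probability (1/64)^2, small enough to beat
    the number of patterns. *)
Definition tail_level : R := 64^-1 ^+ 2 / 2.

Lemma tail_level_gt0 : 0 < tail_level.
Proof. by rewrite divr_gt0// exprn_gt0// invr_gt0. Qed.

(** Weights whose quantile is too close to 0 or 1 for [boost_gain] to apply. *)
Definition extreme : set R := ~` [set z | tail_level <= F z <= 1 - tail_level].

Lemma extremeE : extreme = [set z | F z < tail_level] `|` [set z | 1 - tail_level < F z].
Proof.
apply/seteqP; split => z /=; rewrite /extreme /=.
  by move/negP; rewrite negb_and -!ltNge => /orP[]; [left|right].
by move=> + /andP[h1 h2] => -[]; rewrite ltNge ?h1 ?h2.
Qed.

Lemma measurable_extreme : measurable extreme.
Proof.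
apply: measurableC.
have -> : [set z | tail_level <= F z <= 1 - tail_level] =
    F @^-1` `[tail_level, 1 - tail_level]%classic.
  by apply/seteqP; split => z /=; rewrite in_itv.
by rewrite -[X in measurable X]setTI; exact: (measurable_rcdf rF).
Qed.

Lemma extreme_le e : (P (w e @^-1` extreme) <= ((64^-1 : R) ^+ 2)%:E)%E.
Proof.
have mle v : measurable [set t | F (w e t) <= v].
  rewrite -[X in measurable X]/(w e @^-1` [set z | F z <= v]).
  by apply: measurable_funPTI; exact: (measurable_rcdf_le rF).
apply: (@le_trans _ _ (P ([set t | F (w e t) <= tail_level] `|`
    ~` [set t | F (w e t) <= 1 - tail_level]))).
  apply: le_measure; rewrite ?inE.
  - by apply: measurable_funPTI; exact: measurable_extreme.
  - by apply: measurableU => //; exact: measurableC.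
  - rewrite extremeE => t /= [/ltW|h]; [by left|right].
    by apply/negP; rewrite -ltNge.
apply: (@le_trans _ _ (P [set t | (F (w e t) <= tail_level)%R] +
    P (~` [set t | (F (w e t) <= 1 - tail_level)%R]))%E).
  by apply: measureU2 => //; exact: measurableC.
rewrite probability_setC// !PFX; [|by rewrite /tail_level; lra|by rewrite /tail_level; lra].
by rewrite -EFinB -EFinD lee_fin /tail_level; lra.
Qed.

(** Proportional to the inverse distance, which makes both the squares and the
    gains along a path sum to harmonic sums; the normalization makes the sum of
    squares bounded by 1/2 ([prod_tilt_strength_le]). *)
Definition tilt_strength (e : edge) : R :=
  if (l1_dist x e.1 <= n)%N then 8^-1 / ((l1_dist x e.1).+1%:R * rH) else 0.

Lemma harmonic_ge1 : 1 <= harmonic_sum R n.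
Proof.
have : (0 < n)%N by [].
case: n => // k _; rewrite /harmonic_sum big_ord_recl /= invr1 lerDl.
by apply: sumr_ge0 => i _; rewrite invr_ge0.
Qed.

Lemma rH_ge1 : 1 <= rH.
Proof. by rewrite -sqrtr1 ler_wsqrtr// harmonic_ge1. Qed.

Lemma rH_gt0 : 0 < rH. Proof. exact: lt_le_trans rH_ge1. Qed.

Lemma tilt_strength_ge0 e : 0 <= tilt_strength e.
Proof.
rewrite /tilt_strength; case: ifP => // _.
by rewrite divr_ge0// mulr_ge0// ltW// rH_gt0.
Qed.

Lemma tilt_strength_le1 e : tilt_strength e <= 1.
Proof.
rewrite /tilt_strength; case: ifP => // _.
have h : 1 <= (l1_dist x e.1).+1%:R * rH by rewrite mulr_ege1 ?ler1n// rH_ge1.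
rewrite ler_pdivrMr; last exact: lt_le_trans h.
by rewrite mul1r (le_trans _ h)//; lra.
Qed.

Lemma tilt_strength_sq e :
  tilt_strength e ^+ 2 <= (64 * harmonic_sum R n)^-1 * ((l1_dist x e.1).+1%:R ^+ 2)^-1.
Proof.
have H0 : 0 < harmonic_sum R n by exact: lt_le_trans harmonic_ge1.
rewrite /tilt_strength; case: ifP => _; last first.
  by rewrite expr0n /= mulr_ge0// invr_ge0 ?mulr_ge0// ltW.
rewrite expr_div_n exprMn sqr_sqrtr; last exact: ltW.
have z0 : (0 : R) < (l1_dist x e.1).+1%:R by [].
move: z0 H0; move: (l1_dist x e.1).+1%:R (harmonic_sum R n) => z H z0 H0.
rewrite le_eqVlt; apply/orP; left; apply/eqP; field.
by rewrite !gt_eqF.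
Qed.

Lemma prod_tilt_strength_le :
  \prod_(e <- ball_edges x n) (1 + tilt_strength e ^+ 2) <= expR 2^-1.
Proof.
have H0 : 0 < harmonic_sum R n by exact: lt_le_trans harmonic_ge1.
apply: (@le_trans _ _ (expR (\sum_(e <- ball_edges x n) tilt_strength e ^+ 2))).
  rewrite expR_sum; apply: ler_prod => e _.
  by rewrite expR_ge1Dx andbT addr_ge0 ?sqr_ge0.
rewrite ler_expR; apply: le_trans (ler_sum _ _) _; first by move=> e _; exact: tilt_strength_sq.
rewrite -mulr_sumr; apply: le_trans (ler_wpM2l _ (sum_ball_edges_le R x xy)) _.
  by rewrite invr_ge0 mulr_ge0// ltW.
rewrite le_eqVlt; apply/orP; left; apply/eqP; rewrite -/n; field.
by rewrite gt_eqF.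
Qed.

Let S := ball_edges x n.
Let bw := boosted w F tilt_strength S.

Lemma boosted_ge e t : w e t <= bw t e.
Proof.
rewrite /bw /boosted; case: ifP => // _.
exact: (boost_ge rF (tilt_strength_ge0 e) (tilt_strength_le1 e)).
Qed.

Definition gain : R := tail_level / (2 * M) / 32.

Lemma gain_gt0 : 0 < gain.
Proof.
have M0 := rcdf_M_gt0 rF.
by rewrite divr_gt0// divr_gt0 ?tail_level_gt0// mulr_gt0.
Qed.

(** Apply [path_gain] to the gain from [boost_gain]: more than half of the edges
    have moderate weights, and a sum of [k / (8 * i * rH)] over [i <= n] is of
    order [rH ^+ 2 / rH = rH]. *)
Lemma boosted_path_gain t q : ~ bad_before w extreme x n t ->
  path adjacent x q -> last x q = y -> uniq (x :: q) ->
  gain * rH <= path_weight (fun e => bw t e - w e t) x q.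
Proof.
move=> good xq lq uq.
have M0 := rcdf_M_gt0 rF; have rH0 := rH_gt0.
pose k : R := tail_level / (2 * M).
have k0 : 0 < k by rewrite divr_gt0 ?tail_level_gt0// mulr_gt0.
pose h (i : nat) : R := k * 8^-1 / (i.+1%:R * rH).
have k8 : 0 < k * 8^-1 by apply: mulr_gt0.
have r0 i : 0 < i.+1%:R * rH by apply: mulr_gt0.
have h0 i : 0 <= h i by apply: divr_ge0; exact: ltW.
have hd i : h i.+1 <= h i.
  apply: ler_wpM2l; first exact: ltW.
  rewrite lef_pV2 ?posrE//.
  by apply: ler_wpM2r; [exact: ltW|rewrite ler_nat].
have nq : (n <= size q)%N.
  by have := l1_path_size x xq; rewrite lq {2}/l1_dist !subrr.
have := @path_gain R h (fun e => w e t \notin extreme) (fun e => bw t e - w e t) x q n h0 hd.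
move=> /(_ _ _ xq nq) pg.
apply: le_trans (pg _ _ _); last 3 first.
- by move=> e; rewrite subr_ge0 boosted_ge.
- move=> e ge le; rewrite lerBrDl /bw /boosted mem_ball_edges//.
  have := boost_gain rF (tilt_strength_ge0 e) (tilt_strength_le1 e) (q := tail_level) (w_ge0 e t).
  have ge' : tail_level <= F (w e t) <= 1 - tail_level.
    by move: ge; rewrite notin_setE /extreme /= => /contrapT.
  move=> /(_ ge'); apply: le_trans; rewrite lerD2l /tilt_strength le /h -/k.
  by rewrite [leRHS]mulrC mulrA.
- move=> m mn.
  have := few_bad_edges good xq uq nq mn.
  by congr (2 * _ < _)%N; apply: eq_count => e /=; rewrite negbK.
have sum_ge : harmonic_sum R n / 2 <= \sum_(i < n) i.+2%:R^-1 :> R.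
  rewrite /harmonic_sum mulr_suml; apply: ler_sum => i _.
  rewrite -invfM lef_pV2 ?posrE ?mulr_gt0//.
  by rewrite -natrM ler_nat muln2 -addnn addSn addnS !ltnS leq_addr.
have -> : \sum_(i < n) h i.+1 = k * 8^-1 / rH * \sum_(i < n) i.+2%:R^-1.
  by rewrite mulr_sumr; apply: eq_bigr => i _; rewrite /h invfM mulrA mulrAC.
have H2 : harmonic_sum R n = rH ^+ 2.
  by rewrite sqr_sqrtr// (le_trans ler01 harmonic_ge1).
have kr0 : 0 <= k * 8^-1 / rH by apply: divr_ge0; exact: ltW.
have := ler_wpM2l kr0 sum_ge; rewrite H2.
have -> : k * 8^-1 / rH * (rH ^+ 2 / 2) = k * rH / 16 by field; rewrite gt_eqF.
by rewrite /gain -/k; lra.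
Qed.

Lemma passage_time_boosted_ge t : ~ bad_before w extreme x n t ->
  passage_time (fun e => w e t) x y + gain * rH <= passage_time (bw t) x y.
Proof.
move=> good; apply: passage_time_ge_add => //.
- by move=> e; exact: boosted_ge.
- by move=> q; exact: boosted_path_gain.
Qed.

(** Outside [bad_before] the passage time and its increased version cannot both
    lie between [a] and [b]. With K = exp (1/2), if the event missed only probability
    1/(16 K), the increased version would miss with probability at most
    1/4 + 1/16, too little to cover the event minus [bad_before]. *)
Lemma passage_time_anticoncentration a b : b - a < gain * rH ->
  (P [set t | (a <= passage_time (fun e => w e t) x y <= b)%R] <=
   (1 - (16 * expR 2^-1)^-1)%:E)%E.
Proof.
move=> ab; set A := [set t | _].
pose K : R := expR 2^-1; have K1 : 1 <= K by rewrite -expR0 ler_expR.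
pose Z := [set z : configuration (R:=R) edge |
    a <= passage_time (fun e => Num.max (z e) 0) x y <= b].
have mZ : measurable Z by exact: measurable_passage_event.
have AE : (fun t e => w e t) @^-1` Z = A.
  apply/seteqP; split => t /=; rewrite /A /Z /=;
  (suff -> : (fun e => Num.max (w e t) 0) = (fun e => w e t) by []);
  by apply/funext => e; rewrite max_l.
pose A' := [set t | a <= passage_time (bw t) x y <= b].
have bw0 t e : 0 <= bw t e by apply: le_trans (boosted_ge e t).
have AE' : bw @^-1` Z = A'.
  apply/seteqP; split => t /=; rewrite /A' /Z /=;
  (suff -> : (fun e => Num.max (bw t e) 0) = bw t by []);
  by apply/funext => e; rewrite max_l.
have uS : uniq S by exact: undup_uniq.
have mA : measurable A.
  by rewrite -AE -[X in measurable X]setTI; exact: (measurable_sample w S).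
have mA' : measurable A'.
  rewrite -AE' -[X in measurable X]setTI.
  exact: (measurable_boosted w rF tilt_strength_ge0 tilt_strength_le1).
have law : P (~` A') = tilted w rF tilt_strength_ge0 tilt_strength_le1 S (~` A).
  rewrite -AE -AE'.
  exact: (boosted_law w_indep rF PX PFX tilt_strength_ge0 tilt_strength_le1 uS
    (measurableC mZ)).
have tl := tilted_le w_indep rF PFX tilt_strength_ge0 tilt_strength_le1 uS
  (lt_le_trans ltr01 K1) (measurableC mA).
have cover : (P A <= P (~` A') + P (bad_before w extreme x n))%E.
  have mbad := @measurable_bad_before _ T R P w extreme measurable_extreme x n.
  apply: le_trans (measureU2 _ _ mbad); last exact: measurableC.
  apply: le_measure; rewrite ?inE//; first by apply: measurableU => //; exact: measurableC.
  move=> t /andP[at_ tb]; have [|good] := pselect (bad_before w extreme x n t); first by right.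
  left => /andP[_ tb']; have := passage_time_boosted_ge good; lra.
have bad := bad_before_le w_indep measurable_extreme extreme_le x n.
have fP (E : set T) : measurable E -> P E = (fine (P E))%:E.
  by move=> mE; rewrite fineK// fin_num_measure.
have mbad := @measurable_bad_before _ T R P w extreme measurable_extreme x n.
rewrite law in cover; move: cover bad tl.
rewrite probability_setC// (fP _ mA) (fP _ mbad); set p := fine _; set r := fine _.
move=> + r7 tl.
move=> /le_trans -/(_ _ (leeD tl r7)).
rewrite -EFinB -!EFinM -!EFinD !lee_fin => h.
have prodK : (4 * K)^-1 * (\prod_(i <- S) (1 + tilt_strength i ^+ 2)) <= 4^-1.
  rewrite invfM -mulrA ler_piMr// mulrC ler_pdivrMr; last exact: lt_le_trans K1.
  by rewrite mul1r prod_tilt_strength_le.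
rewrite leNgt; apply/negP => hp.
have Kc : K * (1 - p) <= 16^-1.
  have K0 : 0 < K by exact: lt_le_trans K1.
  have p1 : 1 - p <= (16 * K)^-1 by rewrite -/K in hp; lra.
  apply: le_trans (ler_wpM2l (ltW K0) p1) _.
  by rewrite invfM mulrCA divff ?mulr1// gt_eqF.
have cK : (16 * K)^-1 <= 16^-1.
  by rewrite lef_pV2 ?posrE ?mulr_gt0 ?(lt_le_trans ltr01 K1)// ler_peMr.
by rewrite -/K in hp; lra.
Qed.

End anticoncentration.

(** As [m >= c * n] and [c ^+ 2 * n >= 1], (c n)^2 >= n, so
    ln n <= 2 * ln (c n) <= 2 * H. *)
Lemma sqrt_ln_le (R : realType) (c : R) (n m : nat) : 0 < c -> (0 < n)%N ->
  1 <= c ^+ 2 * n%:R -> c * n%:R <= m%:R ->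
  Num.sqrt (ln n%:R) <= 2 * Num.sqrt (harmonic_sum R m).
Proof.
move=> c0 n0 cn nm.
have n0' : (0 : R) < n%:R by rewrite ltr0n.
have cn0 : 0 < c * n%:R by rewrite mulr_gt0.
have H1 : ln (c * n%:R) <= harmonic_sum R m.
  apply: le_trans (ln_le_harmonic_sum R m); rewrite ler_ln ?posrE//.
  by rewrite (le_trans nm)// ler_nat.
have H2 : ln n%:R <= 2 * ln (c * n%:R).
  rewrite mulr_natl -lnXn// ler_ln ?posrE ?exprn_gt0//.
  have -> : (c * n%:R) ^+ 2 = c ^+ 2 * n%:R * n%:R by ring.
  by apply: ler_peMl => //; exact: ltW.
have H0 : 0 <= harmonic_sum R m by apply: sumr_ge0 => i _; rewrite invr_ge0.
have -> : 2 * Num.sqrt (harmonic_sum R m) = Num.sqrt (2 ^+ 2 * harmonic_sum R m).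
  by rewrite sqrtrM ?sqr_ge0// sqrtr_sqr ger0_norm.
rewrite ler_wsqrtr//.
by lra.
Qed.

Unset Implicit Arguments.

Theorem theorem2p6 (R : realType) (d : measure_display) (T : measurableType d)
    (P : probability T R)
    (w : edge -> {RV P >-> R})
    (w_ge0 : forall (e : edge) (t : T), 0 <= w e t)
    (w_indep : mutually_independent w)
    (w_ident : identically_distributed w)
    (f : R -> R) (f_class : class_Pplus1 f)
    (w_density : forall e : edge, has_density_on_halfline (w e) f)
    (x y : nat -> vertex) (c C : R) (c_gt0 : 0 < c) (c_le_C : c <= C)
    (xy_dist : \forall n \near \oo,
      c * n%:R <= euclidean_dist R (x n) (y n) <= C * n%:R) :
  fluctuations_of_order_at_least
    (fun n => passage_time_rv w_ge0 (x n) (y n))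
    (fun n => Num.sqrt (ln n%:R)).
Proof.
(* The common distribution function depends on the density only. *)
pose e0 : edge := ((0, 0), false).
have [M rF] := density_cdf_regular f_class (w_density e0).
have PX e v := density_cdfE (w_density e) v.
have PFX e v := density_cdf_uniform f_class (w_density e) (v := v).
have g0 := gain_gt0 rF.
(* One factor 2 is lost in [sqrt_ln_le], the other makes the bound strict. *)
exists (gain M / 4), (16 * expR 2^-1)^-1; split.
- by rewrite divr_gt0.
- by rewrite invr_gt0 mulr_gt0// expR_gt0.
near=> n => a b ab ba.
have n0 : (0 < n)%N by near: n; exact: nbhs_infty_gt.
have cn : 1 <= c ^+ 2 * n%:R.
  rewrite mulrC -ler_pdivrMr ?exprn_gt0//; near: n; exact: nbhs_infty_ger.
have /andP[dn _] : c * n%:R <= euclidean_dist R (x n) (y n) <= C * n%:R by near: n.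
have ln_ := le_trans dn (le_l1_euclidean R (x n) (y n)).
have l0 : (0 < l1_dist (x n) (y n))%N.
  by rewrite -(ltr_nat R); apply: lt_le_trans ln_; rewrite mulr_gt0// ltr0n.
apply: (passage_time_anticoncentration w_ge0 w_indep rF PX PFX l0).
apply: (le_lt_trans ba).
have := sqrt_ln_le c_gt0 n0 cn ln_; have := rH_gt0 R l0.
set H := Num.sqrt (harmonic_sum _ _); set L := Num.sqrt _ => H0 LH.
have gL : gain M / 4 * L <= gain M / 4 * (2 * H) by rewrite ler_wpM2l// divr_ge0// ltW.
have gH : 0 < gain M * H by rewrite mulr_gt0.
by apply: le_lt_trans gL _; lra.
Unshelve. all: by end_near. Qed.
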